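(* Let $\alpha,\beta,K,d=\Theta(1)$ (constants not depending on $n$), $\mathcal G\in\{\mathcal O(d),\mathcal{SO}(d)\}$, $p=\frac{\alpha\log n}{n}$, $q=\frac{\beta\log n}{n}$, $m=n/K$. Suppose the observation matrix $\bm A$ is generated by $\mathrm{SGBM}(n,p,q,K,d,\mathcal G)$ for the given ground truth matrix $\bm V^*$ with clustering function $C^*$. If $$\sqrt{2K\beta}<\alpha\qquad\text{and}\qquad \alpha-\sqrt{2K\beta}\,\log\frac{e\alpha}{\sqrt{2K\beta}}>K,$$ then, for sufficiently large $n$, with probability at least $1-n^{-\Omega(1)}$ the following two conditions hold simultaneously: (i) there exists a constant $\chi>0$ such that $\bm A$ preserves $\bm V^*$ by $\chi mp$-separation; (ii) for all $i\in[n]$, $\mu(\bm A\bm V^* )_{iC^*(i)}\ge\frac{\sqrt{2K\beta}}{\alpha}mp$.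
   Context: **Basic notation.** $[n]=\{1,\dots,n\}$. There are $n$ agents in $K$ clusters of equal size $m=n/K$. $\mathcal O(d)$ and $\mathcal{SO}(d)$ are the real orthogonal and rotation groups. $\mathcal G^n\subset\mathbb R^{nd\times d}$ is the set of vertical stacks $\bm R=(\bm R_1;\dots;\bm R_n)$ of $d\times d$ blocks $\bm R_i\in\mathcal G$. For a matrix whose dimensions are multiples of $d$, $\bm X_{ij}$ is its $(i,j)$-th $d\times d$ block. $\otimes$ is the Kronecker product, $\odot$ the entrywise product, $\mathbf 1_{a\times b}$ the all-ones matrix, $\|\cdot\|_*$ the nuclear norm. **Feasible sets.** $\mathcal H=\{\bm H\in\{0,1\}^{n\times K}:\bm H\mathbf 1_{K\times1}=\mathbf 1_{n\times1},\ \mathbf 1_{1\times n}\bm H=m\mathbf 1_{1\times K}\}$; $\bm H\in\mathcal H$ corresponds to the clustering function $C:[n]\to[K]$ with $\bm H_{ij}=1$ iff $C(i)=j$. Put $\mathcal E=\{(\mathbf 1_{1\times K}\otimes\bm R)\odot(\bm H\otimes\mathbf 1_{d\times d}):\bm R\in\mathcal G^n,\bm H\in\mathcal H\}\subset\mathbb R^{nd\times Kd}$, and let $\mathcal F$ be the same set with $\mathcal G$ replaced by $\mathcal O(d)$; $C$ is called the clustering function of the corresponding matrix $\bm V$. **SGBM.** Given a ground truth $\bm R^*\in\mathcal G^n$, $\bm H^*\in\mathcal H$ with clustering function $C^*$, and $\bm V^*=(\mathbf 1_{1\times K}\otimes\bm R^* )\odot(\bm H^*\otimes\mathbf 1_{d\times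 d})\in\mathcal E$, the model $\mathrm{SGBM}(n,p,q,K,d,\mathcal G)$ generates a random symmetric $\bm A\in\mathbb R^{nd\times nd}$ with $\bm A_{ii}=\bm I_d$ and, for $i<j$ independently: if $C^*(i)=C^*(j)$, $\bm A_{ij}=w_{ij}\bm R_i^*\bm R_j^{*\top}$ with $w_{ij}\sim\mathrm{Bern}(p)$; if $C^*(i)\ne C^*(j)$, $\bm A_{ij}=u_{ij}\bm R_{ij}$ with $u_{ij}\sim\mathrm{Bern}(q)$ and $\bm R_{ij}\sim\mathrm{Unif}(\mathcal G)$ (Haar) independent; and $\bm A_{ji}=\bm A_{ij}^\top$. **Separation.** $\mu:\mathbb R^{nd\times Kd}\to\mathbb R^{n\times K}$, $\mu(\bm X)_{ij}=\|\bm X_{ij}\|_*$. For $\bm V\in\mathcal F$ with clustering function $C$ and $\bm M=\mu(\bm A\bm V)$, $\bm A$ is said to preserve $\bm V$ by $\delta$-separation if $\bm M_{iC(i)}-\bm M_{ij}\ge\delta>0$ for all $i\in[n]$ and all $j\in[K]$, $j\ne C(i)$. ''Constant'' means not depending on $n$.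
   Formalization: For the rotation group SO(d) the formal theorem requires d ≥ 2: SO(1) = {1} is excluded, since there the noise is not centered and the claim is false (e.g. d = 1, K = 2, α = 250, β = 10000); O(1) is kept. *)

(* Defs.v *)
From HB Require Import structures.
From mathcomp Require Import all_boot all_order all_algebra.
From mathcomp Require Import all_classical all_reals all_analysis.
From mathcomp Require Import polyrcf mxtens.

Set Implicit Arguments.
Unset Strict Implicit.
Unset Printing Implicit Defensive.

Import Order.TTheory GRing.Theory Num.Theory.
Import numFieldNormedType.Exports.

Local Open Scope classical_set_scope.
Local Open Scope ring_scope.

Definition orthogonal_group (R : realType) (d : nat) : set 'M[R]_d :=
  [set Q : 'M[R]_d | Q^T *m Q = 1%:M].

Definition rotation_group (R : realType) (d : nat) : set 'M[R]_d :=
  [set Q : 'M[R]_d | Q^T *m Q = 1%:M /\ \det Q = 1].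

(* Rows and columns of matrices with dimensions n * d are indexed through
   [mxtens_index : 'I_n * 'I_d -> 'I_(n * d)], the indexing of the Kronecker
   product [tensmx]: it sends (i, a) to i * d + a. *)
Definition block (R : realType) (n k d : nat) (X : 'M[R]_(n * d, k * d))
    (i : 'I_n) (j : 'I_k) : 'M[R]_d :=
  mxsub (fun a : 'I_d => mxtens_index (i, a))
        (fun b : 'I_d => mxtens_index (j, b)) X.

Definition stack_block (R : realType) (n d : nat) (X : 'M[R]_(n * d, d))
    (i : 'I_n) : 'M[R]_d :=
  rowsub (fun a : 'I_d => mxtens_index (i, a)) X.

Definition stacks (R : realType) (n d : nat) (G : set 'M[R]_d) :
    set 'M[R]_(n * d, d) :=
  [set X : 'M[R]_(n * d, d) | forall i, G (stack_block X i)].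

(* The cluster size n / K is a real quotient; the column condition makes the
   set empty unless K divides n. *)
Definition cluster_mx (R : realType) (n K : nat) : set 'M[R]_(n, K) :=
  [set H : 'M[R]_(n, K) | [/\ forall i j, H i j = 0 \/ H i j = 1,
               H *m const_mx 1 = const_mx 1 :> 'cV[R]_n &
               const_mx 1 *m H = const_mx (n%:R / K%:R) :> 'rV[R]_K]].

Definition clustering_of (R : realType) (n K : nat) (H : 'M[R]_(n, K))
    (C : 'I_n -> 'I_K) : Prop :=
  forall i j, H i j = 1 <-> C i = j.

(* The cast identifies the row dimension 1 * (n * d) of the first Kronecker
   product with n * d. *)
Definition assemble (R : realType) (n K d : nat) (X : 'M[R]_(n * d, d))
    (H : 'M[R]_(n, K)) : 'M[R]_(n * d, K * d) :=
  map2_mx *%R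
    (castmx (mul1n (n * d), erefl (K * d)%N)
       (tensmx (const_mx 1 : 'M[R]_(1, K)) X))
    (tensmx H (const_mx 1 : 'M[R]_(d, d))).

Definition feasible (R : realType) (n K d : nat) (G : set 'M[R]_d)
    (V : 'M[R]_(n * d, K * d)) (C : 'I_n -> 'I_K) : Prop :=
  exists X H, [/\ stacks G X, cluster_mx H, clustering_of H C &
                  V = assemble X H].

(* Sum of the singular values: the square roots of the eigenvalues of X^T X,
   counted with their multiplicities as roots of its characteristic
   polynomial ([rootsR] lists each real root once). *)
Definition nuclear_norm (R : realType) (d : nat) (X : 'M[R]_d) : R :=
  let p := char_poly (X^T *m X) in
  \sum_(x <- rootsR p) Num.sqrt x *+ mup x p.

Definition mu_mx (R : realType) (n K d : nat) (X : 'M[R]_(n * d, K * d)) :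
    'M[R]_(n, K) :=
  \matrix_(i, j) nuclear_norm (block X i j).

Definition preserves (R : realType) (n K d : nat) (A : 'M[R]_(n * d, n * d))
    (V : 'M[R]_(n * d, K * d)) (C : 'I_n -> 'I_K) (delta : R) : Prop :=
  [/\ feasible (@orthogonal_group R d) V C, 0 < delta &
      forall (i : 'I_n) (j : 'I_K), j != C i ->
        delta <= mu_mx (A *m V) i (C i) - mu_mx (A *m V) i j].

Definition borel_mx (R : realType) (d : nat) :=
  g_sigma_algebraType (@open 'M[R]_d).

(* nu is the law, as a measure on all d x d matrices, of a Haar-distributed
   element of the compact group G: it is carried by G and left-invariant. *)
Definition haar_law (R : realType) (d : nat) (G : set 'M[R]_d)
    (nu : set (borel_mx R d) -> \bar R) : Prop :=
  nu G = 1%E /\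
  forall Q : 'M[R]_d, G Q -> forall B : set (borel_mx R d), measurable B ->
    nu [set Q *m (X : 'M[R]_d) | X in B] = nu B.

(* Mutual independence of the set systems F i, for i ranging over D. *)
Definition mutually_independent (dT : measure_display) (T : measurableType dT)
    (R : realType) (P : probability T R) (I : finType) (D : {set I})
    (F : I -> set (set T)) : Prop :=
  forall (J : {set I}) (E : I -> set T), J \subset D ->
    (forall i, i \in J -> F i (E i)) ->
    P (\bigcap_(i in [set` J]) E i) = (\prod_(i in J) P (E i))%E.

(* The sigma-algebras of the edge variables, indexed by [inl (i, j)], and of
   the noise rotations, indexed by [inr (i, j)]. *)
Definition sgbm_sigma (dT : measure_display) (T : measurableType dT)
    (R : realType) (P : probability T R) (n K d : nat) (C : 'I_n -> 'I_K)
    (w u : 'I_n -> 'I_n -> {RV P >-> bool})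
    (N : 'I_n -> 'I_n -> {RV P >-> borel_mx R d})
    (x : ('I_n * 'I_n) + ('I_n * 'I_n)) : set (set T) :=
  match x with
  | inl (i, j) => if C i == C j then g_sigma_algebra_preimage (w i j)
                  else g_sigma_algebra_preimage (u i j)
  | inr (i, j) => g_sigma_algebra_preimage (N i j)
  end.

(* Only pairs i < j carry randomness, and only those across clusters carry a
   noise rotation; the remaining entries of w, u and N are unconstrained. *)
Definition sgbm_indices (n K : nat) (C : 'I_n -> 'I_K) :
    {set ('I_n * 'I_n) + ('I_n * 'I_n)} :=
  [set x : ('I_n * 'I_n) + ('I_n * 'I_n) | match x with
           | inl (i, j) => (i < j)%N
           | inr (i, j) => (i < j)%N && (C i != C j)
           end].

Record sgbm_with (dT : measure_display) (T : measurableType dT)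
    (R : realType) (P : probability T R) (n K d : nat) (p q : R)
    (G : set 'M[R]_d) (Xs : 'M[R]_(n * d, d)) (C : 'I_n -> 'I_K)
    (w u : 'I_n -> 'I_n -> {RV P >-> bool})
    (N : 'I_n -> 'I_n -> {RV P >-> borel_mx R d})
    (A : T -> 'M[R]_(n * d, n * d)) : Prop := SgbmWith {
  sgbm_independent :
    mutually_independent P (sgbm_indices C) (sgbm_sigma C w u N) ;
  sgbm_within_law : forall i j : 'I_n, (i < j)%N -> C i = C j ->
    distribution P (w i j) = bernoulli_prob p ;
  sgbm_across_law : forall i j : 'I_n, (i < j)%N -> C i <> C j ->
    distribution P (u i j) = bernoulli_prob q ;
  sgbm_noise_law : forall i j : 'I_n, (i < j)%N -> C i <> C j ->
    haar_law G (distribution P (N i j)) ;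
  sgbm_symmetric : forall t, (A t)^T = A t ;
  sgbm_diagonal : forall t i, block (A t) i i = 1%:M ;
  sgbm_within : forall t (i j : 'I_n), (i < j)%N -> C i = C j ->
    block (A t) i j =
      (w i j t)%:R *: (stack_block Xs i *m (stack_block Xs j)^T) ;
  sgbm_across : forall t (i j : 'I_n), (i < j)%N -> C i <> C j ->
    block (A t) i j = (u i j t)%:R *: (N i j t : 'M[R]_d)
}.

(* A ~ SGBM(n, p, q, K, d, G) with ground truth rotations Xs and clustering
   function C. *)
Definition sgbm (dT : measure_display) (T : measurableType dT)
    (R : realType) (P : probability T R) (n K d : nat) (p q : R)
    (G : set 'M[R]_d) (Xs : 'M[R]_(n * d, d)) (C : 'I_n -> 'I_K)
    (A : T -> 'M[R]_(n * d, n * d)) : Prop :=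
  exists w u N, @sgbm_with dT T R P n K d p q G Xs C w u N A.

(* Main.v *)
Require Import Defs.
From mathcomp Require Import all_boot all_order all_algebra.
From mathcomp Require Import all_classical all_reals all_analysis.
From mathcomp Require Import complex polyrcf mxtens spectral.
From mathcomp Require Import measurable_realfun ring lra.
Import Order.TTheory GRing.Theory Num.Theory.
Import numFieldNormedType.Exports.
Import HBNNSimple.

Local Open Scope classical_set_scope.
Local Open Scope ring_scope.

(* Fix an agent i. Its own block of A V* is (1 + Z) R*_i, where Z counts the
   observed edges inside the cluster of i, and has nuclear norm d (1 + Z); the
   block of another cluster is a sum over its agents of u_k Q_k, with u_k the
   edge variables and Q_k Haar distributed. The nuclear norm of this sum is the
   maximum of its inner products with contractions, hence is controlled by
   finitely many of them, forming a net whose size does not depend on n. For a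
   contraction B the numbers y_k = <B, Q_k> / d are centered and lie in [-1, 1],
   so that E exp (l y_k) <= cosh l, and by independence
     P (Z <= sum_k u_k y_k) <= exp (m p (exp (- l) - 1) + m q (cosh l - 1)).
   Write s = sqrt (2 K beta). The hypothesis forces alpha > s + K, which is what
   makes the right-hand side o(1 / n) for exp l = 1 + 2 K / s: signal and noise
   have to be treated jointly, since the noise alone may exceed s log n / K with
   probability larger than 1 / n. The bound (ii) is the Chernoff bound for the
   lower tail of Z, whose rate is the one in the hypothesis. A union bound over
   i, the clusters and the net concludes. *)

(** * Real spectral theorem *)

(** Since m p = alpha log n / K, a bound exp (- (a / K) log n) survives the union over n agents when
    a > K; every comparison of a rate with K has this origin. The joint rate is concave in l, and
    exp l = 1 + 2 K / s is its exact maximizer in the boundary case alpha = s + K, where the maximum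
    equals K; the same l is kept for larger alpha. The strict inequality leaves a margin that pays
    for the separation chi, the error of the net and the constants of the union bound. An agent has
    no edge to itself, so m - 1 replaces m in the signal, which costs only a constant factor. Of the
    noise law only its mass on G and its left invariance are given. Centering comes from sign
    changes of rows that lie in G: one row for O(d), two rows for SO(d), hence d > 1 there, the
    noise of SO(1) being constant. The nuclear norm is defined by roots of a characteristic
    polynomial; a real spectral theorem makes it a maximum over contractions, and nets of decreasing
    mesh then give its measurability, needed for the good event. *)

Lemma symmetric_eigenvalue (R : rcfType) (n : nat) (S : 'M[R]_n.+1) :
  S^T = S -> exists a, eigenvalue S a.
Proof.
move=> S_sym.
(* Over [R[i]] the matrix is Hermitian, hence unitarily diagonalizable with a real diagonal. Its
   first diagonal entry is a root of the characteristic polynomial, which has coefficients in [R],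
   so it is an eigenvalue over [R] too. *)
set SC : 'M[R[i]]_n.+1 := map_mx (real_complex R) S.
have SC_herm : SC \is hermsymmx.
  apply/is_hermitianmxP; rewrite expr0 scale1r; apply/matrixP => i j.
  rewrite !mxE -[in LHS]S_sym mxE; apply/esym/CrealP.
  by apply/complex_realP; exists (S j i).
have /hermitian_normalmx/orthomx_spectralP SC_eq := SC_herm.
have /mxOverP/(_ 0 0)/complex_realP[a aE] := hermitian_spectral_diag_real SC_herm.
exists a; rewrite eigenvalue_root_char -(fmorph_root (real_complex R)).
rewrite map_char_poly -/SC -eigenvalue_root_char.
apply/eigenvalueP; exists (row 0 (spectralmx SC)).
  rewrite {2}SC_eq -row_mul mulmxA mulmxA mulmxV ?spectral_unit// mul1mx.
  by rewrite row_mul row_diag_mx -scalemxAl -rowE aE.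
apply/negP => /eqP row_eq0.
have := spectral_unit SC; rewrite -row_free_unit => /row_free_inj.
move=> /(_ 1 (delta_mx 0 0) 0); rewrite -rowE row_eq0 mul0mx => /(_ erefl).
by move=> /matrixP/(_ 0 0); rewrite !mxE eqxx => /eqP; rewrite oner_eq0.
Qed.

(** The witness is the reflection in the hyperplane orthogonal to w = e_0 - v. It swaps the unit
    vectors e_0 and v because c = |w|^2 equals 2 <e_0, w>. *)
Lemma householder (R : realFieldType) (n : nat) (v : 'rV[R]_n.+1) :
  v *m v^T = 1%:M ->
  exists H : 'M[R]_n.+1, [/\ H^T = H, H *m H = 1%:M & delta_mx 0 0 *m H = v].
Proof.
move=> v1; have [->|v_neq] := eqVneq v (delta_mx 0 0).
  by exists 1%:M; split; rewrite ?trmx1 ?mulmx1.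
pose w := delta_mx 0 0 - v; pose c := (w *m w^T) 0 0.
have e1 : (delta_mx 0 0 : 'rV[R]_n.+1) *m (delta_mx 0 0)^T = 1%:M.
  rewrite trmx_delta mul_delta_mx; apply/matrixP => i j.
  by rewrite !ord1 !mxE.
have wwE : w *m w^T = c%:M by rewrite [LHS]mx11_scalar.
have ew : delta_mx 0 0 *m w^T = (c / 2)%:M.
  have ve : v *m (delta_mx 0 0)^T = delta_mx 0 0 *m v^T.
    rewrite -[RHS]trmxK trmx_mul trmxK.
    by apply/matrixP => i j; rewrite [RHS]mxE !ord1.
  have cE : c%:M = 2 *: (delta_mx 0 0 *m w^T).
    rewrite -wwE /w linearB/= mulmxBl !mulmxBr ve e1 v1.
    by apply/matrixP => i j; rewrite !mxE; ring.
  have -> : (c / 2)%:M = 2^-1 *: c%:M :> 'M[R]_1 by rewrite scale_scalar_mx mulrC.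
  by rewrite cE scalerA mulVf ?scale1r.
have c_neq0 : c != 0.
  apply: contra v_neq => /eqP c0; rewrite eq_sym -subr_eq0; apply/eqP/rowP => k.
  have := c0; rewrite /c mxE => /eqP; rewrite psumr_eq0; last first.
    by move=> i _; rewrite [X in _ * X]mxE -expr2 sqr_ge0.
  move=> /allP/(_ k (mem_index_enum _))/=; rewrite [w^T _ _]mxE.
  by rewrite mulf_eq0 orbb => /eqP ->; rewrite mxE.
have wE : w = delta_mx 0 0 - v by [].
clearbody c; clearbody w.
exists (1%:M - (2 / c) *: (w^T *m w)); split.
- by rewrite linearB/= trmx1 linearZ/= trmx_mul trmxK.
- have WW : w^T *m w *m (w^T *m w) = c *: (w^T *m w).
    by rewrite mulmxA -(mulmxA w^T) wwE mul_mx_scalar -scalemxAl.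
  rewrite mulmxBl mul1mx mulmxBr mulmx1 -scalemxAl -scalemxAr WW !scalerA.
  have -> : 2 / c * (2 / c) * c = 2 / c + 2 / c by field.
  by rewrite scalerDl opprB addrK subrK.
- rewrite mulmxBr mulmx1 -scalemxAr mulmxA ew mul_scalar_mx scalerA.
  have -> : 2 / c * (c / 2) = 1 by field.
  by rewrite scale1r wE opprB addrC subrK.
Qed.

(** Deflation: conjugating by a reflection that carries e_0 to a unit eigenvector clears the first
    row outside the diagonal, and by symmetry the first column, so that the induction applies to the
    lower right block. *)
Lemma symmetric_spectral (R : rcfType) (n : nat) (S : 'M[R]_n) : S^T = S ->
  exists (V : 'M[R]_n) (D : 'rV[R]_n), V^T *m V = 1%:M /\ S = V *m diag_mx D *m V^T.
Proof.
elim: n S => [|n IHn] S S_sym.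
  by exists 1%:M, 0; split; apply/matrixP => -[].
have [a /eigenvalueP[u uS u_neq0]] := symmetric_eigenvalue R n S S_sym.
pose r := (u *m u^T) 0 0.
have r_gt0 : 0 < r.
  rewrite lt_neqAle; apply/andP; split; last first.
    by rewrite /r mxE sumr_ge0// => i _; rewrite [u^T _ _]mxE -expr2 sqr_ge0.
  rewrite eq_sym; apply: contra u_neq0 => /eqP; rewrite /r mxE => /eqP.
  rewrite psumr_eq0; last by move=> i _; rewrite [u^T _ _]mxE -expr2 sqr_ge0.
  move=> /allP u0; apply/eqP/rowP => k.
  by have := u0 k (mem_index_enum _); rewrite /= [u^T _ _]mxE mulf_eq0 orbb => /eqP ->; rewrite mxE.
pose v := (Num.sqrt r)^-1 *: u.
have v1 : v *m v^T = 1%:M.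
  rewrite /v linearZ/= -scalemxAl -scalemxAr scalerA [u *m _]mx11_scalar -/r.
  by rewrite -invfM -expr2 sqr_sqrtr ?ltW// scale_scalar_mx mulVf ?gt_eqF.
have vS : v *m S = a *: v by rewrite /v -scalemxAl uS !scalerA mulrC.
have [H [H_sym HH eH]] := householder R n v v1.
pose M : 'M[R]_(1 + n) := H *m S *m H.
have M_sym : M^T = M by rewrite /M !trmx_mul S_sym H_sym mulmxA.
have eM : (delta_mx 0 0 : 'rV[R]_(1 + n)) *m M = a *: delta_mx 0 0.
  by rewrite /M !mulmxA eH vS -scalemxAl -eH -mulmxA HH mulmx1.
have SM : S = H *m M *m H by rewrite /M !mulmxA HH mul1mx -mulmxA HH mulmx1.
clearbody M.
have row0 j : M 0 j = a * (j == 0)%:R.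
  by have /rowP/(_ j) := eM; rewrite -rowE !mxE.
have ME : M = block_mx a%:M 0 0 (drsubmx M).
  rewrite -[LHS]submxK; congr block_mx.
  - by apply/matrixP => i j; rewrite !ord1 !mxE !lshift0 row0 eqxx mulr1.
  - apply/matrixP => i j; rewrite ord1 !mxE lshift0 row0.
    by rewrite (_ : _ == _ = false) ?mulr0.
  - apply/matrixP => i j; rewrite ord1 !mxE lshift0.
    by rewrite -[M in LHS]M_sym mxE row0 (_ : _ == _ = false) ?mulr0.
have [|V [D [VV SE]]] := IHn (drsubmx M).
  by rewrite trmx_drsub M_sym.
pose W : 'M[R]_(1 + n) := block_mx 1%:M 0 0 V.
pose E : 'rV[R]_(1 + n) := row_mx a%:M D.
have WW : W^T *m W = 1%:M.
  rewrite tr_block_mx trmx1 !trmx0 mulmx_block.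
  by rewrite !(mulmx0, mul0mx, mul1mx, addr0, add0r) VV -scalar_mx_block.
have WE : W *m diag_mx E *m W^T = M.
  rewrite diag_mx_row tr_block_mx trmx1 !trmx0 !mulmx_block.
  rewrite !(mulmx0, mul0mx, mul1mx, mulmx1, addr0, add0r) -SE [RHS]ME.
  by congr block_mx; apply/matrixP => i j; rewrite !ord1 !mxE.
clearbody W E; exists (H *m W), E; split.
  by rewrite trmx_mul H_sym mulmxA -(mulmxA _ H H) HH mulmx1.
by rewrite trmx_mul H_sym SM -WE !mulmxA.
Qed.

(** * The nuclear norm and contractions *)

Lemma mup_prod_XsubC (F : fieldType) (I : Type) (s : seq I) (D : I -> F) (x : F) :
  mup x (\prod_(i <- s) ('X - (D i)%:P)) = (\sum_(i <- s) (D i == x))%N.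
Proof.
elim: s => [|i s IHs].
  by rewrite !big_nil mupNroot// root1.
rewrite !big_cons mupM ?polyXsubC_eq0 ?monic_neq0 ?monic_prod_XsubC// IHs.
by rewrite -['X - _]expr1 mup_XsubCX; case: eqP.
Qed.

(** The weights [mup] restore the repetitions that [rootsR] drops. *)
Lemma sum_rootsR_prod_XsubC (R : rcfType) (n : nat) (D : 'I_n -> R) (f : R -> R) :
  let p := \prod_(i < n) ('X - (D i)%:P) in
  \sum_(x <- rootsR p) f x *+ mup x p = \sum_i f (D i).
Proof.
move=> p.
have p_neq0 : p != 0 by rewrite monic_neq0// monic_prod_XsubC.
under eq_bigr do rewrite mup_prod_XsubC -sumrMnr.
rewrite exchange_big/=; apply: eq_bigr => i _.
have iR : D i \in rootsR p.
  rewrite -(roots_on_rootsR p_neq0) in_itv/=.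
  rewrite /root horner_prod (bigD1 i)//= hornerXsubC subrr mul0r eqxx//.
rewrite (bigD1_seq (D i)) ?uniq_roots//= eqxx big1 ?addr0// => x.
by rewrite eq_sym => /negPf ->.
Qed.

Lemma char_poly_orthogonal_diag (R : comNzRingType) (n : nat) (V : 'M[R]_n) (D : 'rV[R]_n) :
  V^T *m V = 1%:M ->
  char_poly (V *m diag_mx D *m V^T) = \prod_(i < n) ('X - (D 0 i)%:P).
Proof.
move=> VV; have VV' : V *m V^T = 1%:M by exact: mulmx1C.
transitivity (char_poly (diag_mx D)); last first.
  rewrite char_poly_trig ?diag_mx_is_trig//.
  by apply: eq_bigr => i _; rewrite mxE eqxx mulr1n.
rewrite /char_poly; pose W := map_mx polyC V.
have WW : W *m W^T = 1%:M by rewrite /W map_trmx -map_mxM VV' map_mx1.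
have -> : char_poly_mx (V *m diag_mx D *m V^T) = W *m char_poly_mx (diag_mx D) *m W^T.
  rewrite /char_poly_mx mulmxBr mulmxBl !map_mxM -map_trmx -/W; congr (_ - _).
  by rewrite mul_mx_scalar -scalemxAl WW scalemx1.
by rewrite !det_mulmx mulrAC -det_mulmx WW det1 mul1r.
Qed.

(* The unit ball of the operator norm, dual to the nuclear norm. Contractions are
   used rather than orthogonal matrices so that the maximizer of
   [fun B => \tr (B^T *m X)] may be a partial isometry. *)
Definition contractive_mx {R : realType} {d : nat} : set 'M[R]_d :=
  [set B | forall v : 'cV[R]_d,
    ((B *m v)^T *m (B *m v)) 0 0 <= (v^T *m v) 0 0].

Lemma trmx_mul_self (R : realType) (n : nat) (v : 'cV[R]_n) :
  (v^T *m v) 0 0 = \sum_k v k 0 ^+ 2.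
Proof. by rewrite mxE; apply: eq_bigr => k _; rewrite mxE. Qed.

(** Cauchy-Schwarz for a vector of norm at most 1: sum 2 s a b <= s^2 a^2 + b^2 over the indices,
    with s the right-hand side. The case s = 0 is separate because s is cancelled at the end. *)
Lemma sum_mul_le_sqrt (R : realType) (n : nat) (a b : 'I_n -> R) :
  \sum_i a i ^+ 2 <= 1 -> \sum_i a i * b i <= Num.sqrt (\sum_i b i ^+ 2).
Proof.
move=> a1; set D := \sum_i b i ^+ 2.
have D_ge0 : 0 <= D by apply: sumr_ge0 => i _; exact: sqr_ge0.
have [D_gt0|] := ltP 0 D; last first.
  move=> D_le0; have D0 : D = 0 by apply/le_anti/andP.
  have /eqP : D = 0 by [].
  rewrite psumr_eq0; last by move=> i _; exact: sqr_ge0.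
  move=> /allP b0; rewrite D0 sqrtr0 big1// => i _.
  by have := b0 i (mem_index_enum _); rewrite /= sqrf_eq0 => /eqP ->; rewrite mulr0.
set s := Num.sqrt D.
have s_gt0 : 0 < s by rewrite sqrtr_gt0.
have ss : s ^+ 2 = D by rewrite sqr_sqrtr.
have le2 : (2 * s) * (\sum_i a i * b i) <= s ^+ 2 * (\sum_i a i ^+ 2) + D.
  rewrite !mulr_sumr -big_split/=; apply: ler_sum => i _.
  have := sqr_ge0 (s * a i - b i); nra.
have : (2 * s) * (\sum_i a i * b i) <= (2 * s) * s.
  apply: le_trans le2 _; rewrite -ss; nra.
by rewrite ler_pM2l ?mulr_gt0.
Qed.

Lemma gram_diag (R : realType) (d : nat) (X V : 'M[R]_d) (D : 'rV[R]_d) :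
  V^T *m V = 1%:M -> X^T *m X = V *m diag_mx D *m V^T ->
  (X *m V)^T *m (X *m V) = diag_mx D.
Proof.
move=> VV XX; rewrite trmx_mul -mulmxA (mulmxA X^T) XX !mulmxA VV mul1mx.
by rewrite -mulmxA VV mulmx1.
Qed.

Lemma gram_diag_col (R : realType) (d : nat) (Y : 'M[R]_d) (D : 'rV[R]_d) (i : 'I_d) :
  Y^T *m Y = diag_mx D -> D 0 i = \sum_k Y k i ^+ 2.
Proof.
move=> /matrixP/(_ i i); rewrite !mxE eqxx mulr1n => <-.
by apply: eq_bigr => k _; rewrite mxE.
Qed.

Lemma nuclear_norm_spectral (R : realType) (d : nat) (X V : 'M[R]_d) (D : 'rV[R]_d) :
  V^T *m V = 1%:M -> X^T *m X = V *m diag_mx D *m V^T ->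
  nuclear_norm X = \sum_i Num.sqrt (D 0 i).
Proof.
move=> VV XX; rewrite /nuclear_norm XX char_poly_orthogonal_diag//.
exact: sum_rootsR_prod_XsubC.
Qed.

(** In an eigenbasis [V] of X^T X the trace is a sum of inner products of the columns of B V, of
    norm at most 1, with those of X V, whose norms are the singular values of X. *)
Lemma trace_contraction_le (R : realType) (d : nat) (B X : 'M[R]_d) :
  contractive_mx B -> \tr (B^T *m X) <= nuclear_norm X.
Proof.
move=> Bc; have [|V [D [VV XX]]] := symmetric_spectral R d (X^T *m X).
  by rewrite trmx_mul trmxK.
have YY := gram_diag _ _ _ _ _ VV XX.
rewrite (nuclear_norm_spectral _ _ _ _ _ VV XX).
have -> : B^T *m X = V *m ((B *m V)^T *m (X *m V)) *m V^T.
  have VV' : V *m V^T = 1%:M by exact: mulmx1C.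
  by rewrite trmx_mul !mulmxA VV' mul1mx -mulmxA VV' mulmx1.
rewrite -mulmxA mxtrace_mulC -mulmxA VV mulmx1; apply: ler_sum => i _.
rewrite (gram_diag_col _ _ _ _ _ YY) mxE.
under eq_bigr do rewrite mxE.
apply: sum_mul_le_sqrt; have := Bc (col i V).
have cV : ((col i V)^T *m col i V) 0 0 = 1.
  transitivity ((V^T *m V) i i); last by rewrite VV mxE eqxx.
  by rewrite !mxE; apply: eq_bigr => k _; rewrite !mxE.
rewrite cV trmx_mul_self => le1; apply: le_trans le1.
by apply: ler_sum => k _; rewrite colE mulmxA -colE [col _ _ _ _]mxE.
Qed.

Lemma nuclear_norm_attained (R : realType) (d : nat) (X : 'M[R]_d) :
  exists2 B : 'M[R]_d, contractive_mx B & nuclear_norm X = \tr (B^T *m X).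
Proof.
have [|V [D [VV XX]]] := symmetric_spectral R d (X^T *m X).
  by rewrite trmx_mul trmxK.
have VV' : V *m V^T = 1%:M by exact: mulmx1C.
have YY := gram_diag _ _ _ _ _ VV XX.
move: YY; have [Y YE] : exists Y, Y = X *m V by exists (X *m V).
rewrite -YE => YY.
have D_ge0 i : 0 <= D 0 i.
  by rewrite (gram_diag_col _ _ _ _ _ YY) sumr_ge0// => k _; exact: sqr_ge0.
(* The maximizer is the polar factor of X. As the inverse of 0 is 0, it vanishes on the kernel of X,
   which makes it a partial isometry. *)
pose e : 'rV[R]_d := \row_i (Num.sqrt (D 0 i))^-1.
exists (Y *m diag_mx e *m V^T).
  move=> v; pose w := V^T *m v.
  have -> : v^T *m v = w^T *m w.
    by rewrite /w trmx_mul trmxK mulmxA -(mulmxA v^T) VV' mulmx1.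
  have -> : Y *m diag_mx e *m V^T *m v = Y *m (diag_mx e *m w).
    by rewrite /w !mulmxA.
  rewrite trmx_mul mulmxA -(mulmxA _ Y^T) YY trmx_mul_self mxE.
  clearbody w; apply: ler_sum => k _; rewrite mul_mx_diag mul_diag_mx !mxE.
  have [->|Dk] := eqVneq (D 0 k) 0; first by rewrite !(mulr0, mul0r) sqr_ge0.
  have Dk_gt0 : 0 < D 0 k by rewrite lt_neqAle eq_sym Dk D_ge0.
  have s_gt0 : 0 < Num.sqrt (D 0 k) by rewrite sqrtr_gt0.
  rewrite -[X in _ * X * _](sqr_sqrtr (D_ge0 k)).
  rewrite le_eqVlt; apply/orP; left; apply/eqP; field; exact: lt0r_neq0.
rewrite (nuclear_norm_spectral _ _ _ _ _ VV XX).
rewrite !trmx_mul trmxK tr_diag_mx -(mulmxA V) mxtrace_mulC -!mulmxA -YE YY.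
rewrite mul_diag_mx; apply: eq_bigr => i _; rewrite !mxE eqxx mulr1n.
have [->|Di] := eqVneq (D 0 i) 0; first by rewrite sqrtr0 mulr0.
have Di_gt0 : 0 < D 0 i by rewrite lt_neqAle eq_sym Di D_ge0.
have s_gt0 : 0 < Num.sqrt (D 0 i) by rewrite sqrtr_gt0.
by rewrite -[X in _ * X](sqr_sqrtr (D_ge0 i)) expr2 mulrA mulVf ?mul1r ?gt_eqF.
Qed.

Lemma nuclear_norm_scale_orthogonal (R : realType) (d : nat) (c : R) (Q : 'M[R]_d) :
  0 <= c -> Q^T *m Q = 1%:M -> nuclear_norm (c *: Q) = d%:R * c.
Proof.
move=> c_ge0 QQ; rewrite (nuclear_norm_spectral _ _ _ 1%:M (const_mx (c ^+ 2))).
- under eq_bigr do rewrite mxE sqrtr_sqr ger0_norm//.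
  by rewrite sumr_const card_ord mulr_natl.
- by rewrite trmx1 mulmx1.
- rewrite trmx1 mul1mx mulmx1 diag_const_mx.
  have -> : (c *: Q)^T = c *: Q^T by apply/matrixP => i j; rewrite !mxE.
  rewrite -scalemxAl -scalemxAr QQ.
  by rewrite scalerA scalemx1 -expr2.
Qed.

Lemma contractive_mx0 (R : realType) (d : nat) : contractive_mx (0 : 'M[R]_d).
Proof.
move=> v; rewrite mul0mx mulmx0 mxE trmx_mul_self.
by apply: sumr_ge0 => k _; exact: sqr_ge0.
Qed.

Lemma contractive_mxN (R : realType) (d : nat) (B : 'M[R]_d) :
  contractive_mx B -> contractive_mx (- B).
Proof.
move=> Bc v; have -> : - B *m v = - (B *m v) by rewrite mulNmx.
by rewrite [(- _)^T]linearN mulNmx mulmxN opprK; exact: Bc.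
Qed.

Lemma contractive_mx_entry (R : realType) (d : nat) (B : 'M[R]_d) (a b : 'I_d) :
  contractive_mx B -> `|B a b| <= 1.
Proof.
move=> /(_ (delta_mx b 0)); rewrite -colE !trmx_mul_self => Bc.
rewrite -(@ler_pXn2r _ 2)// ?nnegrE// expr1n real_normK ?num_real//.
have -> : 1 = \sum_k (delta_mx b 0 : 'cV[R]_d) k 0 ^+ 2.
  rewrite (bigD1 b)//= mxE !eqxx expr1n big1 ?addr0// => k kb.
  by rewrite mxE (negPf kb) expr0n.
apply: le_trans Bc; rewrite (bigD1 a)//= mxE lerDl.
by apply: sumr_ge0 => k _; exact: sqr_ge0.
Qed.

Lemma orthogonal_entry (R : realType) (d : nat) (X : 'M[R]_d) (a b : 'I_d) :
  X^T *m X = 1%:M -> `|X a b| <= 1.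
Proof.
move=> XX; apply: contractive_mx_entry => v.
by rewrite trmx_mul mulmxA -(mulmxA _ X^T) XX mulmx1.
Qed.

Lemma trace_contraction_orthogonal (R : realType) (d : nat) (B Q : 'M[R]_d) :
  contractive_mx B -> Q^T *m Q = 1%:M -> `|\tr (B^T *m Q)| <= d%:R.
Proof.
move=> Bc QQ; have nQ : nuclear_norm Q = d%:R.
  by rewrite -[Q]scale1r nuclear_norm_scale_orthogonal ?mulr1.
rewrite ler_norml -{2}nQ trace_contraction_le// andbT lerNl.
by rewrite -linearN -mulNmx -linearN/= -nQ trace_contraction_le//; exact: contractive_mxN.
Qed.

(** Grid points need not be contractions, so the entries, which lie in [-1, 1], are cut into cells
    of side 1 / N and one contraction is picked from each cell that contains any. *)
Lemma contractive_mx_net (R : realType) (d : nat) (e : R) : 0 < e ->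
  exists s : seq 'M[R]_d,
    (forall B, B \in s -> contractive_mx B) /\
    forall B, contractive_mx B ->
      exists2 B', B' \in s & forall a b, `|B a b - B' a b| <= e.
Proof.
move=> e_gt0.
pose N := (Num.truncn e^-1).+1.
have N_gt0 : 0 < N%:R :> R by rewrite ltr0n.
have Ne : N%:R^-1 < e.
  by rewrite -[e]invrK ltf_pV2 ?posrE ?invr_gt0// truncnS_gt.
(* An entry equal to 1 falls into cell 2 N, whence 2 N + 1 cells per entry. *)
pose cell (B : 'M[R]_d) : {ffun 'I_d * 'I_d -> 'I_(2 * N).+1} :=
  [ffun ab => inord (Num.truncn ((B ab.1 ab.2 + 1) * N%:R))].
(* For a cell without contractions the default 0 is returned, itself a contraction. *)
pose rep c := xget 0 [set B | contractive_mx B /\ cell B = c].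
exists [seq rep c | c <- enum {ffun 'I_d * 'I_d -> 'I_(2 * N).+1}]; split.
  move=> B /mapP[c _ ->]; rewrite /rep; case: xgetP => [? _ []//|_].
  exact: contractive_mx0.
move=> B Bc; exists (rep (cell B)); first by apply: map_f; rewrite mem_enum.
rewrite /rep; case: xgetP => [B' _ [B'c]|/(_ B)]; last by move=> /not_andP[].
move=> /ffunP cellE a b; have := cellE (a, b); rewrite !ffunE/= => /(congr1 val)/=.
have cell_itv (C : 'M[R]_d) : contractive_mx C ->
    let m := Num.truncn ((C a b + 1) * N%:R) in
    (m < (2 * N).+1)%N /\ m%:R <= (C a b + 1) * N%:R < m.+1%:R.
  move=> /(contractive_mx_entry _ _ _ a b); rewrite ler_norml => /andP[C1 C2].
  have C0 : 0 <= (C a b + 1) * N%:R by rewrite mulr_ge0 ?ler0n//; lra.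
  have /andP[m1 m2] := truncn_itv C0; split; last by rewrite m1.
  rewrite ltnS -(ler_nat R) (le_trans m1)// natrM ler_wpM2r ?ler0n//; lra.
have [m1 /andP[B1 B2]] := cell_itv _ Bc; have [m1' /andP[B1' B2']] := cell_itv _ B'c.
rewrite !inordK// => mE; rewrite mE in B1' B2'.
apply: le_trans (ltW Ne); rewrite -[N%:R^-1]mul1r ler_pdivlMr//.
rewrite -[X in _ * X]gtr0_norm// -normrM ler_norml.
move: B1 B2 B1' B2'; rewrite -natr1; set m := _%:R.
by move=> B1 B2 B1' B2'; apply/andP; split; lra.
Qed.

(** The error is expressed by the entrywise l1 norm because that is subadditive: for a sum of noise
    terms it can be charged to each term separately. *)
Lemma nuclear_norm_le_net (R : realType) (d : nat) (e : R) (s : seq 'M[R]_d) (X : 'M[R]_d) :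
  (forall B, contractive_mx B ->
      exists2 B', B' \in s & forall a b, `|B a b - B' a b| <= e) ->
  exists2 B, B \in s &
    nuclear_norm X <= \tr (B^T *m X) + e * (\sum_a \sum_b `|X a b|).
Proof.
move=> net; have [B Bc ->] := nuclear_norm_attained _ _ X.
have [B' B's BB'] := net _ Bc; exists B' => //.
rewrite -lerBlDl -linearB/= -mulmxBl -linearB/= mulr_sumr.
under [leRHS]eq_bigr do rewrite mulr_sumr.
rewrite [leRHS]exchange_big/=; apply: ler_sum => b _; rewrite mxE; apply: ler_sum => a _.
rewrite !mxE; apply: le_trans (ler_norm _) _; rewrite normrM ler_wpM2r ?normr_ge0//.
Qed.

(** * Expectations of products of independent variables *)

(** Factorization for indicators of events determined by [X] extends to [X] itself through simple
    functions and monotone convergence. *)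
Lemma integral_weight_mul (dT : measure_display) (T : measurableType dT) (R : realType)
    (P : probability T R) (W X : T -> R) :
  measurable_fun setT W -> (forall t, 0 <= W t) ->
  measurable_fun setT X -> (forall t, 0 <= X t) ->
  (\int[P]_t (W t)%:E \is a fin_num)%E ->
  (forall B : set R, measurable B ->
    (\int[P]_t (W t * \1_(X @^-1` B) t)%:E
       = \int[P]_t (W t)%:E * P (X @^-1` B))%E) ->
  (\int[P]_t (W t * X t)%:E = \int[P]_t (W t)%:E * \int[P]_t (X t)%:E)%E.
Proof.
move=> mW W0 mX X0 Wfin WB.
(* The approximation takes place on the real line, not on [T], so that its level sets pull back to
   preimages under [X], as the hypothesis on [W] demands. The maximum makes f nonnegative
   everywhere. *)
pose f : R -> \bar R := fun r => (Num.max r 0)%:E.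
have mf : measurable_fun [set: R] f.
  by apply/measurable_EFinP; exact: measurable_maxr.
have f0 r : setT r -> (0 <= f r)%E by move=> _; rewrite lee_fin le_max lexx orbT.
pose f_ := nnsfun_approx measurableT mf.
have fX t : (X t)%:E = f (X t) by rewrite /f max_l.
have f_cvg t : (fun n => (f_ n (X t))%:E) @ \oo --> (X t)%:E.
  by rewrite fX; exact: (cvg_nnsfun_approx measurableT mf).
have mfX n : measurable_fun setT (fun t => f_ n (X t)).
  exact: (measurableT_comp (measurable_funPT (f_ n))).
have simple n : (\int[P]_t (W t * f_ n (X t))%:E
    = \int[P]_t (W t)%:E * \int[P]_t (f_ n (X t))%:E)%E.
  have mA k : measurable (X @^-1` (f_ n @^-1` [set k])).
    by rewrite -[X in measurable X]setTI; exact: mX.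
  have m1 k : measurable_fun setT (fun t => \1_(X @^-1` (f_ n @^-1` [set k])) t : R).
    exact: measurable_indic.
  have mk k : measurable_fun setT (fun t => (k * \1_(X @^-1` (f_ n @^-1` [set k])) t)%:E).
    by apply/measurable_EFinP; exact: measurable_funM.
  have ge0 k t : (0 <= (k * \1_(X @^-1` (f_ n @^-1` [set k])) t)%:E)%E.
    by have := nnfun_muleindic_ge0 (f_ n) k (X t); rewrite -EFinM.
  have -> : (\int[P]_t (f_ n (X t))%:E =
      \sum_(k \in range (f_ n)) k%:E * P (X @^-1` (f_ n @^-1` [set k])))%E.
    under eq_integral do rewrite fimfunE -fsumEFin//.
    rewrite ge0_integral_fsum//; last by move=> k t _; exact: ge0.
    apply: eq_fsbigr => k _.
    rewrite (integralZl_indic _ (fun k => X @^-1` (f_ n @^-1` [set k])))//.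
      by rewrite integral_indic// setIT.
    by move=> k0; rewrite preimage_nnfun0// preimage_set0.
  transitivity (\sum_(k \in range (f_ n))
      \int[P]_t (k * (W t * \1_(X @^-1` (f_ n @^-1` [set k])) t))%:E)%E.
    rewrite -ge0_integral_fsum//.
    - apply: eq_integral => t _; rewrite fimfunE fsumEFin//; congr (_%:E).
      rewrite mulr_fsumr//; apply: eq_fsbigr => k _.
      by rewrite mulrCA.
    - move=> k; apply/measurable_EFinP; apply: measurable_funM => //.
      by apply: measurable_funM.
    - move=> k t _; rewrite mulrCA EFinM mule_ge0 ?lee_fin//.
      exact: ge0.
  rewrite ge0_mule_fsumr; last first.
    move=> k; have [k_ge0|k_lt0] := leP 0 k; first by rewrite mule_ge0 ?lee_fin.
    by rewrite preimage_nnfun0// preimage_set0 measure0 mule0.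
  apply: eq_fsbigr => k; rewrite inE => -[r _ rk].
  have k_ge0 : 0 <= k by rewrite -rk; exact: fun_ge0.
  under eq_integral do rewrite EFinM.
  rewrite ge0_integralZl_EFin//.
  - by rewrite WB// muleCA.
  - by move=> t _; rewrite lee_fin mulr_ge0.
  - by apply/measurable_EFinP; apply: measurable_funM.
have lim1 : (\int[P]_t (W t * f_ n (X t))%:E @[n --> \oo] -->
    \int[P]_t (W t * X t)%:E)%E.
  have -> : (\int[P]_t (W t * X t)%:E = \int[P]_t limn (fun n => (W t * f_ n (X t))%:E))%E.
    apply: eq_integral => t _; apply/esym/cvg_lim => //.
    under eq_fun do rewrite EFinM.
    by rewrite EFinM; apply: cvgeZl => //.
  apply: cvg_monotone_convergence => //.
  - by move=> n; apply/measurable_EFinP; exact: measurable_funM.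
  - by move=> n t _; rewrite lee_fin mulr_ge0.
  - move=> t _ m n mn; rewrite lee_fin ler_wpM2l//.
    exact/lefP/nd_nnsfun_approx.
have lim2 : (\int[P]_t (f_ n (X t))%:E @[n --> \oo] --> \int[P]_t (X t)%:E)%E.
  have -> : (\int[P]_t (X t)%:E = \int[P]_t limn (fun n => (f_ n (X t))%:E))%E.
    by apply: eq_integral => t _; apply/esym/cvg_lim.
  apply: cvg_monotone_convergence => //.
  - by move=> n; apply/measurable_EFinP.
  - by move=> n t _; rewrite lee_fin.
  - by move=> t _ m n mn; rewrite lee_fin; exact/lefP/nd_nnsfun_approx.
rewrite (funext simple) in lim1.
exact: (cvg_unique _ lim1 (cvgeZl Wfin lim2)).
Qed.

(** The operation is left general to cover sums, products and finite maxima. *)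
Lemma measurable_bigop (dT : measure_display) (T : measurableType dT) (R : realType)
    (op : R -> R -> R) (idx : R) (I : Type) (s : seq I) (Q : pred I) (h : I -> T -> R) :
  (forall f g : T -> R, measurable_fun setT f -> measurable_fun setT g ->
     measurable_fun setT (fun t => op (f t) (g t))) ->
  (forall i, Q i -> measurable_fun setT (h i)) ->
  measurable_fun setT (fun t => \big[op/idx]_(i <- s | Q i) h i t).
Proof.
move=> mop mh; elim: s => [|i s IHs]; first last.
  under eq_fun do rewrite big_cons; case: (boolP (Q i)) => // Qi.
  exact: mop (mh i Qi) IHs.
by under eq_fun do rewrite big_nil; exact: measurable_cst.
Qed.

Lemma measurable_sumr (dT : measure_display) (T : measurableType dT) (R : realType)
    (I : Type) (s : seq I) (Q : pred I) (h : I -> T -> R) :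
  (forall i, Q i -> measurable_fun setT (h i)) ->
  measurable_fun setT (fun t => \sum_(i <- s | Q i) h i t).
Proof. by apply: measurable_bigop => f g; exact: measurable_funD. Qed.

Lemma measurable_prodr (dT : measure_display) (T : measurableType dT) (R : realType)
    (I : Type) (s : seq I) (Q : pred I) (h : I -> T -> R) :
  (forall i, Q i -> measurable_fun setT (h i)) ->
  measurable_fun setT (fun t => \prod_(i <- s | Q i) h i t).
Proof. by apply: measurable_bigop => f g; exact: measurable_funM. Qed.

(** The last clause is measurability with respect to [F], phrased with preimages because [F] is a
    bare set system. *)
Definition adapted {dT : measure_display} {T : measurableType dT} {R : realType}
    (P : probability T R) (F : set (set T)) (g : T -> R) : Prop :=
  [/\ measurable_fun setT g, forall t, 0 <= g t,
      (\int[P]_t (g t)%:E \is a fin_num)%E &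
      forall B : set R, measurable B -> F (g @^-1` B)].

Lemma integral_prod_indep_indic (dT : measure_display) (T : measurableType dT) (R : realType)
    (P : probability T R) (I : finType) (D : {set I}) (F : I -> set (set T))
    (E : I -> set T) (J : {set I}) :
  mutually_independent P D F -> J \subset D ->
  (forall i, i \in J -> F i (E i)) -> (forall i, i \in J -> measurable (E i)) ->
  (\int[P]_t (\prod_(i in J) (\1_(E i) t : R))%:E
    = \prod_(i in J) \int[P]_t (\1_(E i) t : R)%:E)%E.
Proof.
move=> indep JD FE mE.
transitivity (P (\bigcap_(i in [set` J]) E i)).
  have mcap : measurable (\bigcap_(i in [set` J]) E i).
    apply: fin_bigcap_measurable => //; exact: finite_finset.
  have <- : (\int[P]_t (\1_(\bigcap_(i in [set` J]) E i) t)%:E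
      = P (\bigcap_(i in [set` J]) E i))%E by rewrite integral_indic// setIT.
  apply: eq_integral => t _; congr (_%:E).
  rewrite [RHS]indicE; case: (asboolP ((\bigcap_(i in [set` J]) E i) t)) => tE.
    rewrite mem_set//; apply: big1 => i iJ; rewrite indicE mem_set//; exact: tE.
  rewrite memNset//.
  have [i iJ tEi] : exists2 i, i \in J & ~ E i t.
    apply: contrapT => /forall2NP H; apply: tE => i /= iJ.
    by have [|/contrapT] := H i.
  by rewrite (big_setD1 i)//= indicE memNset// mul0r.
rewrite (indep J E)//; apply: eq_bigr => i iJ.
by rewrite integral_indic ?setIT//; exact: mE.
Qed.

Lemma integral_prod_indep (dT : measure_display) (T : measurableType dT) (R : realType)
    (P : probability T R) (I : finType) (D : {set I}) (F : I -> set (set T))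
    (f : I -> T -> R) (J : {set I}) :
  mutually_independent P D F ->
  (forall i, i \in D -> F i `<=` measurable) ->
  J \subset D -> (forall i, i \in J -> adapted P (F i) (f i)) ->
  (\int[P]_t (\prod_(i in J) f i t)%:E
    = \prod_(i in J) \int[P]_t (f i t)%:E)%E.
Proof.
move=> indep FT JD fF.
(* Starting from indicators, the factors are made general one at a time. *)
suff main n : forall (J1 J : {set I}) (g : I -> T -> R), #|J1| = n ->
    J1 \subset J -> J \subset D ->
    (forall i, i \in J1 -> adapted P (F i) (g i)) ->
    (forall i, i \in J :\: J1 -> exists2 E, F i E & g i = \1_E) ->
  (\int[P]_t (\prod_(i in J) g i t)%:E
    = \prod_(i in J) \int[P]_t (g i t)%:E)%E.
  apply: (main _ J) => // i; by rewrite finset.setDv inE.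
elim: n => [|n IHn] {JD fF f}J1 {}J g J1n J1J JD gF gE.
  have J10 : J1 = finset.set0 by apply/eqP; rewrite -cards_eq0 J1n.
  have /choice[E HE] : forall i, exists E, i \in J -> F i E /\ g i = \1_E.
    move=> i; have [iJ|iJ] := boolP (i \in J); last by exists set0.
    by have [|E FE gE'] := gE i; [rewrite J10 finset.setD0|exists E].
  transitivity (\int[P]_t (\prod_(i in J) (\1_(E i) t : R))%:E)%E.
    apply: eq_integral => t _; congr (_%:E); apply: eq_bigr => i iJ.
    by rewrite (HE i iJ).2.
  rewrite (@integral_prod_indep_indic _ _ _ _ _ D F)//.
  - by apply: eq_bigr => i iJ; rewrite (HE i iJ).2.
  - by move=> i /HE[].
  - move=> i iJ; exact: (FT i (fintype.subsetP JD i iJ) _ (HE i iJ).1).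
have [a aJ1] : exists a, a \in J1 by apply/card_gt0P; rewrite J1n.
have aJ : a \in J := fintype.subsetP J1J a aJ1.
have g_fin i : i \in J -> [/\ measurable_fun setT (g i), forall t, 0 <= g i t &
    (\int[P]_t (g i t)%:E \is a fin_num)%E].
  move=> iJ; have [/gF[]//|iJ1] := boolP (i \in J1).
  have [|E FE ->] := gE i; first by rewrite inE iJ1.
  have mE : measurable E by exact: (FT i (fintype.subsetP JD i iJ) _ FE).
  split => //; rewrite integral_indic// setIT fin_num_measure//.
have [ma a0 afin Fa] := gF a aJ1.
(* The induction hypothesis serves twice: here with the factor [a] dropped, and below with that
   factor replaced by the indicator of one of its preimages. Together these are the premise of
   [integral_weight_mul]. *)
have IHW : (\int[P]_t (\prod_(i in J :\ a) g i t)%:E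
    = \prod_(i in J :\ a) \int[P]_t (g i t)%:E)%E.
  apply: (IHn (J1 :\ a)).
  - by move: J1n; rewrite (cardsD1 a) aJ1 => -[].
  - exact: finset.setSD.
  - by apply: fintype.subset_trans JD; exact: finset.subD1set.
  - by move=> i; rewrite inE => /andP[_ /gF].
  - move=> i iJ; apply: gE; move: iJ; rewrite !inE.
    by case: (i == a) => //=.
transitivity (\int[P]_t (\prod_(i in J :\ a) g i t * g a t)%:E)%E.
  by apply: eq_integral => t _; rewrite (big_setD1 a aJ)/= mulrC.
rewrite integral_weight_mul//.
- by rewrite IHW [RHS](big_setD1 a)//= muleC.
- apply: measurable_prodr => i; rewrite inE => /andP[_ iJ].
  by have [] := g_fin i iJ.
- move=> t; apply: prodr_ge0 => i; rewrite inE => /andP[_ iJ].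
  by have [] := g_fin i iJ.
- rewrite IHW; apply: (big_ind (fun x => x \is a fin_num)) => // [x y|i]; first exact: fin_numM.
  by rewrite inE => /andP[_ iJ]; have [] := g_fin i iJ.
move=> B mB; rewrite IHW.
pose h i := if i == a then \1_(g a @^-1` B) else g i.
have hE i : i \in J :\ a -> h i = g i.
  by rewrite !inE /h => /andP[/negPf ->].
have ha : h a = \1_(g a @^-1` B) by rewrite /h eqxx.
clearbody h.
have mgB : measurable (g a @^-1` B) by rewrite -[X in measurable X]setTI; exact: ma.
transitivity (\int[P]_t (\prod_(i in J) h i t)%:E)%E.
  apply: eq_integral => t _; rewrite [in RHS](big_setD1 a)//= ha mulrC; congr (_ * _)%:E.
  by apply: eq_bigr => i /hE ->.
rewrite (IHn (J1 :\ a) J h)//.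
- rewrite (big_setD1 a)//= muleC ha integral_indic// setIT; congr (_ * _)%E.
  by apply: eq_bigr => i /hE ->.
- by move: J1n; rewrite (cardsD1 a) aJ1 => -[].
- by apply: fintype.subset_trans J1J; exact: finset.subD1set.
- move=> i; rewrite !inE => /andP[ia iJ1]; rewrite hE ?inE ?ia ?(fintype.subsetP J1J)//.
  exact: gF.
- move=> i; rewrite !inE negb_and negbK; have [->|ia] := eqVneq i a.
    by move=> _; rewrite ha; exists (g a @^-1` B) => //; exact: Fa.
  move=> /andP[/= iJ1 iJ]; rewrite hE ?inE ?ia//.
  by apply: gE; rewrite inE iJ1.
Qed.

(* The shape [a k + b k * c k] is that of [expR (u * y)] for a boolean [u] and a
   factor [y] independent of it: [a k] and [b k] are functions of [u], [c k] of [y]. *)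
Lemma integral_prod_indep_mix (dT : measure_display) (T : measurableType dT) (R : realType)
    (P : probability T R) (I : finType) (D : {set I}) (F : I -> set (set T))
    (K : eqType) (x y : K -> I) (a b c : K -> T -> R) (s : seq K)
    (J : {set I}) (f : I -> T -> R) :
  mutually_independent P D F ->
  (forall i, i \in D -> F i `<=` measurable) ->
  injective x -> injective y -> (forall k k', x k != y k') -> uniq s ->
  J \subset D -> (forall i, i \in J -> adapted P (F i) (f i)) ->
  (forall k, k \in s -> [/\ x k \in D :\: J, y k \in D :\: J,
     adapted P (F (x k)) (a k), adapted P (F (x k)) (b k) & adapted P (F (y k)) (c k)]) ->
  (\int[P]_t (\prod_(i in J) f i t * \prod_(k <- s) (a k t + b k t * c k t))%:E
    = \prod_(i in J) (\int[P]_t (f i t)%:E) *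
      \prod_(k <- s) (\int[P]_t (a k t)%:E + \int[P]_t (b k t)%:E * \int[P]_t (c k t)%:E))%E.
Proof.
move=> indep FT xinj yinj xy; elim: s J f => [|k s IHs] J f.
  move=> _ JD fF _; rewrite big_nil mule1 -(@integral_prod_indep _ _ _ _ _ D F)//.
  by apply: eq_integral => t _; rewrite big_nil mulr1.
rewrite cons_uniq => /andP[ks s_uniq] JD fF abc.
have [xD yD aF bF cF] := abc k (mem_head _ _).
move: xD yD; rewrite !inE => /andP[xJ xD] /andP[yJ yD].
have abcs j : j \in s -> [/\ x j \in D :\: J, y j \in D :\: J, x j != x k, y j != y k &
     [/\ adapted P (F (x j)) (a j), adapted P (F (x j)) (b j) & adapted P (F (y j)) (c j)]].
  move=> js; have [xjD yjD aj bj cj] := abc j (mem_behead (s := k :: s) js).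
  have jk : j != k by apply: contraNneq ks => <-.
  by split => //; rewrite (inj_eq xinj, inj_eq yinj).
pose rest t := \prod_(j <- s) (a j t + b j t * c j t).
pose Rest := (\prod_(j <- s)
    (\int[P]_t (a j t)%:E + \int[P]_t (b j t)%:E * \int[P]_t (c j t)%:E))%E.
(* The head factor is expanded: a k becomes a factor at index x k, and b k * c k two factors at x k
   and y k. This is why the induction carries a general product over [J]. *)
pose f1 i := if i == x k then a k else f i.
pose f2 i := if i == y k then c k else if i == x k then b k else f i.
have yx : y k != x k by rewrite eq_sym.
have x_neq i : i \in J -> i != x k by apply: contraTneq => ->.
have y_neq i : i \in J -> i != y k by apply: contraTneq => ->.
have yJx : y k \notin x k |: J by rewrite !inE negb_or yx.
have I1 : (\int[P]_t (\prod_(i in x k |: J) f1 i t * rest t)%:E =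
    \prod_(i in x k |: J) (\int[P]_t (f1 i t)%:E) * Rest)%E.
  apply: IHs => //.
  - by apply/fintype.subsetP => i; rewrite !inE => /orP[/eqP ->//|/(fintype.subsetP JD)].
  - move=> i; rewrite !inE /f1; case: eqVneq => [->//|_ /=]; exact: fF.
  - move=> j /abcs[xjD yjD xjk yjk []]; split => //.
      by move: xjD; rewrite !inE negb_or xjk.
    by move: yjD; rewrite !inE negb_or eq_sym xy.
have I2 : (\int[P]_t (\prod_(i in y k |: (x k |: J)) f2 i t * rest t)%:E =
    \prod_(i in y k |: (x k |: J)) (\int[P]_t (f2 i t)%:E) * Rest)%E.
  apply: IHs => //.
  - apply/fintype.subsetP => i; rewrite !inE.
    by move=> /or3P[/eqP ->//|/eqP ->//|/(fintype.subsetP JD)].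
  - move=> i; rewrite !inE /f2; case: eqVneq => [->//|_ /=].
    case: eqVneq => [->//|_ /=]; exact: fF.
  - move=> j /abcs[xjD yjD xjk yjk []]; split => //.
      by move: xjD; rewrite !inE !negb_or xjk xy.
    by move: yjD; rewrite !inE !negb_or yjk eq_sym xy.
have f1E t : \prod_(i in x k |: J) f1 i t = a k t * \prod_(i in J) f i t.
  rewrite big_setU1//= {1}/f1 eqxx; congr (_ * _); apply: eq_bigr => i /x_neq.
  by rewrite /f1 => /negPf ->.
have f2E t : \prod_(i in y k |: (x k |: J)) f2 i t = c k t * (b k t * \prod_(i in J) f i t).
  rewrite big_setU1//= {1}/f2 eqxx big_setU1//= {1}/f2 eq_sym (negPf yx) eqxx.
  congr (_ * (_ * _)); apply: eq_bigr => i iJ.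
  by rewrite /f2 (negPf (x_neq _ iJ)) (negPf (y_neq _ iJ)).
have g1E : (\prod_(i in x k |: J) (\int[P]_t (f1 i t)%:E)
    = \int[P]_t (a k t)%:E * \prod_(i in J) \int[P]_t (f i t)%:E)%E.
  rewrite big_setU1//= {1}/f1 eqxx; congr (_ * _)%E; apply: eq_bigr => i /x_neq.
  by rewrite /f1 => /negPf ->.
have g2E : (\prod_(i in y k |: (x k |: J)) (\int[P]_t (f2 i t)%:E)
    = \int[P]_t (c k t)%:E * (\int[P]_t (b k t)%:E * \prod_(i in J) \int[P]_t (f i t)%:E))%E.
  rewrite big_setU1//= {1}/f2 eqxx big_setU1//= {1}/f2 eq_sym (negPf yx) eqxx.
  congr (_ * (_ * _))%E; apply: eq_bigr => i iJ.
  by rewrite /f2 (negPf (x_neq _ iJ)) (negPf (y_neq _ iJ)).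
have mrest : measurable_fun setT rest.
  rewrite /rest; under eq_fun do rewrite big_seq.
  apply: measurable_prodr => j /abcs[_ _ _ _ [[ma _ _ _] [mb _ _ _] [mc _ _ _]]].
  by apply: measurable_funD => //; exact: measurable_funM.
have rest0 t : 0 <= rest t.
  rewrite /rest big_seq; apply: prodr_ge0 => j.
  move=> /abcs[_ _ _ _ [[_ a0 _ _] [_ b0 _ _] [_ c0 _ _]]].
  by rewrite addr_ge0 ?mulr_ge0.
have mf : measurable_fun setT (fun t => \prod_(i in J) f i t).
  by apply: measurable_prodr => i /fF[].
have f0 t : 0 <= \prod_(i in J) f i t by apply: prodr_ge0 => i /fF[].
have [ma a0 _ _] := aF; have [mb b0 _ _] := bF; have [mc c0 _ _] := cF.
transitivity (\int[P]_t ((\prod_(i in x k |: J) f1 i t * rest t)%:E +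
    (\prod_(i in y k |: (x k |: J)) f2 i t * rest t)%:E))%E.
  apply: eq_integral => t _; rewrite -EFinD; congr (_%:E).
  by rewrite big_cons f1E f2E -/(rest t); ring.
rewrite ge0_integralD//=; first last.
- apply/measurable_EFinP; apply: measurable_funM => //.
  under eq_fun do rewrite f2E.
  by apply: measurable_funM => //; exact: measurable_funM.
- by move=> t _; rewrite lee_fin f2E !mulr_ge0.
- apply/measurable_EFinP; apply: measurable_funM => //.
  by under eq_fun do rewrite f1E; exact: measurable_funM.
- by move=> t _; rewrite lee_fin f1E !mulr_ge0.
rewrite I1 I2 g1E g2E big_cons -/Rest.
have int0 (g : T -> R) : (forall t, 0 <= g t) -> (0 <= \int[P]_t (g t)%:E)%E.
  by move=> g0; apply: integral_ge0 => t _; rewrite lee_fin.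
have A0 := int0 _ a0; have B0 := int0 _ b0; have C0 := int0 _ c0.
have J0 : (0 <= \prod_(i in J) \int[P]_t (f i t)%:E)%E.
  by apply: prode_ge0 => i /fF[_ fi0 _ _]; exact: int0.
rewrite -ge0_muleDl ?mule_ge0//; last 1 first.
rewrite [in RHS]muleA; congr (_ * _)%E.
rewrite ge0_muleDr ?mule_ge0//; congr (_ + _)%E; first by rewrite muleC.
by rewrite muleA [LHS]muleC (muleC (\int[P]_t (c k t)%:E)%E).
Qed.

(** * Haar measure *)

Lemma measurable_borel_mx_entry (R : realType) (d : nat) (a b : 'I_d) :
  measurable_fun setT (fun X : borel_mx R d => (X : 'M[R]_d) a b).
Proof.
apply: (measurability (@RGenOInfty.G R)) => [|_ [_ [r ->] <-]].
  exact: RGenOInfty.measurableE.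
rewrite setTI; apply: sub_sigma_algebra.
apply: (open_comp (f := fun X : 'M[R]_d => X a b)); last exact: rray_open.
by move=> X _; exact: coord_continuous.
Qed.

(** Measurability turns full mass of G into almost sure statements. G is cut out by polynomial
    equations in the entries. *)
Lemma measurable_haar_group (R : realType) (d : nat) (G : set 'M[R]_d) :
  (G = @orthogonal_group R d \/ G = @rotation_group R d) ->
  measurable (G : set (borel_mx R d)).
Proof.
pose orth (X : 'M[R]_d) := \sum_a \sum_b ((\sum_k X k a * X k b) - (a == b)%:R) ^+ 2.
pose det (X : 'M[R]_d) := \det X - 1.
have orthE X : orth X = 0 <-> X^T *m X = 1%:M.
  split=> [|XX]; last first.
    rewrite /orth big1// => a _; rewrite big1// => b _.
    have /matrixP/(_ a b) := XX; rewrite !mxE => <-.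
    rewrite -sumrB big1 ?expr0n// => k _; by rewrite mxE subrr.
  move=> /eqP; rewrite psumr_eq0; last first.
    by move=> a _; apply: sumr_ge0 => b _; exact: sqr_ge0.
  move=> /allP X0; apply/matrixP => a b.
  have := X0 a (mem_index_enum _); rewrite /= psumr_eq0; last first.
    by move=> c _; exact: sqr_ge0.
  move=> /allP/(_ b (mem_index_enum _))/=; rewrite sqrf_eq0 subr_eq0 => /eqP X1.
  by rewrite !mxE -X1; apply: eq_bigr => k _; rewrite mxE.
have morth : measurable_fun setT (orth : borel_mx R d -> R).
  apply: measurable_sumr => a _; apply: measurable_sumr => b _.
  apply: measurable_funX; apply: measurable_funB => //.
  apply: measurable_sumr => k _.
  by apply: measurable_funM; exact: measurable_borel_mx_entry.
have mdet : measurable_fun setT (det : borel_mx R d -> R).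
  apply: measurable_funB => //; apply: measurable_sumr => s _.
  apply: measurable_funM => //; apply: measurable_prodr => k _.
  exact: measurable_borel_mx_entry.
have mO : measurable ([set X | orth X = 0] : set (borel_mx R d)).
  by rewrite -[X in measurable X]setTI; exact: (morth measurableT [set 0]).
have mD : measurable ([set X | det X = 0] : set (borel_mx R d)).
  by rewrite -[X in measurable X]setTI; exact: (mdet measurableT [set 0]).
case=> ->.
  rewrite (_ : @orthogonal_group R d = [set X | orth X = 0])//.
  by apply/seteqP; split => X /orthE.
rewrite (_ : @rotation_group R d = [set X | orth X = 0] `&` [set X | det X = 0]).
  exact: measurableI.
apply/seteqP; split => X [/orthE X1 X2]; split => //.
  by apply/eqP; rewrite subr_eq0; apply/eqP.
by move/eqP: X2; rewrite subr_eq0 => /eqP.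
Qed.

Definition row_flip {R : realType} {d : nat} (D : {set 'I_d}) : 'M[R]_d :=
  diag_mx (\row_i (-1) ^+ (i \in D)).

Lemma row_flipE (R : realType) (d : nat) (D : {set 'I_d}) (X : 'M[R]_d) (a b : 'I_d) :
  (row_flip D *m X) a b = (-1) ^+ (a \in D) * X a b.
Proof. by rewrite /row_flip mul_diag_mx !mxE. Qed.

Lemma row_flipK (R : realType) (d : nat) (D : {set 'I_d}) (X : 'M[R]_d) :
  row_flip D *m (row_flip D *m X) = X.
Proof. by apply/matrixP => a b; rewrite !row_flipE mulrA -expr2 sqrr_sign mul1r. Qed.

(** In the rotation group a second row must be flipped along with row [a] to keep the determinant
    1. *)
Lemma row_flip_group (R : realType) (d : nat) (G : set 'M[R]_d) (a : 'I_d) :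
  G = @orthogonal_group R d \/ (G = @rotation_group R d /\ (1 < d)%N) ->
  exists2 D : {set 'I_d}, a \in D & G (row_flip D).
Proof.
have orth D : (row_flip D)^T *m row_flip D = 1%:M :> 'M[R]_d.
  by rewrite tr_diag_mx -[X in _ *m X]mulmx1 row_flipK.
case=> [->|[-> d_gt1]]; first by exists [set a]%SET; rewrite ?inE.
have [b ba] : exists b : 'I_d, b != a.
  have /card_gt0P[b] : (0 < #|[set~ a]%SET|)%N.
    by rewrite cardsC1 card_ord -subn1 subn_gt0.
  by rewrite !inE; exists b.
exists [set a; b]%SET; first by rewrite !inE eqxx.
split => //; rewrite det_diag (bigD1 a)//= (bigD1 b)//= big1.
  by rewrite !mxE !inE !eqxx orbT !expr1 mulr1 mulrNN mulr1.
by move=> i /andP[ia ib]; rewrite mxE !inE (negPf ia) (negPf ib).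
Qed.

(** Left multiplication by a sign change of row [a] preserves the law and negates the entry. *)
Lemma haar_entry_symmetric (R : realType) (d : nat) (G : set 'M[R]_d)
    (nu : probability (borel_mx R d) R) (a b : 'I_d) (S : set R) :
  G = @orthogonal_group R d \/ (G = @rotation_group R d /\ (1 < d)%N) ->
  haar_law G nu -> measurable S ->
  nu [set X | S ((X : 'M[R]_d) a b)] = nu [set X | S (- (X : 'M[R]_d) a b)].
Proof.
move=> hG [_ inv] mS; have [D aD GD] := row_flip_group R d G a hG.
have mB : measurable ([set X | S ((X : 'M[R]_d) a b)] : set (borel_mx R d)).
  rewrite -[X in measurable X]setTI.
  exact: (measurable_borel_mx_entry _ _ a b measurableT S).
rewrite -(inv _ GD _ mB); congr (nu _); apply/seteqP; split => X /=.
  by move=> [Y SY <-]; rewrite row_flipE aD expr1 mulN1r opprK.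
move=> SX; exists (row_flip D *m (X : 'M[R]_d)); last exact: row_flipK.
by rewrite /= row_flipE aD expr1 mulN1r.
Qed.

(* The entries of a Haar matrix are bounded only almost surely; clamping makes
   them bounded everywhere and, being odd, preserves their symmetry. *)
Definition clamp {R : realType} (r : R) : R := Num.max (-1) (Num.min 1 r).

Lemma clampN (R : realType) (r : R) : clamp (- r) = - clamp r.
Proof.
rewrite /clamp; have [r1|r1] := leP r (-1).
  by rewrite [Num.min 1 (- r)]min_l 1?[Num.min 1 r]min_r 1?[Num.max _ 1]max_r
    1?[Num.max _ r]max_l ?opprK//; lra.
have [r2|r2] := leP 1 r.
  by rewrite [Num.min 1 (- r)]min_r 1?[Num.min 1 r]min_l 1?[Num.max _ 1]max_r
    1?[Num.max _ (- r)]max_l//; lra.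
by rewrite [Num.min 1 (- r)]min_r 1?[Num.min 1 r]min_r 1?[Num.max _ (- r)]max_r
  1?[Num.max _ r]max_r//; lra.
Qed.

Lemma clamp_id (R : realType) (r : R) : `|r| <= 1 -> clamp r = r.
Proof. by rewrite ler_norml => /andP[r1 r2]; rewrite /clamp min_r// max_r. Qed.

Lemma clamp_norm (R : realType) (r : R) : `|clamp r| <= 1.
Proof.
by rewrite ler_norml /clamp le_max lexx/= ge_max ge_min lexx andbT; lra.
Qed.

Lemma measurable_clamp (R : realType) : measurable_fun [set: R] (@clamp R).
Proof. by apply: measurable_maxr => //; exact: measurable_minr. Qed.

(** By symmetry of the law and oddness of [clamp] the integral equals its own negative; being
    finite, it is 0. *)
Lemma haar_clamp_entry (R : realType) (d : nat) (G : set 'M[R]_d)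
    (nu : probability (borel_mx R d) R) (a b : 'I_d) :
  G = @orthogonal_group R d \/ (G = @rotation_group R d /\ (1 < d)%N) ->
  haar_law G nu ->
  nu.-integrable setT (fun X => (clamp ((X : 'M[R]_d) a b))%:E) /\
  (\int[nu]_X (clamp ((X : 'M[R]_d) a b))%:E = 0)%E.
Proof.
move=> hG haar.
pose e (X : borel_mx R d) := (X : 'M[R]_d) a b.
have me : measurable_fun setT e by exact: measurable_borel_mx_entry.
have mN : measurable_fun setT (fun X => - e X) by exact: measurableT_comp.
have mc : measurable_fun setT (fun X => clamp (e X)).
  exact: (measurableT_comp (@measurable_clamp R)).
have mcN : measurable_fun setT (fun X => clamp (- e X)).
  exact: (measurableT_comp (@measurable_clamp R)).
have mcR : measurable_fun [set: R] (EFin \o @clamp R).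
  by apply/measurable_EFinP; exact: measurable_clamp.
have bnd (f : borel_mx R d -> R) : measurable_fun setT f ->
    nu.-integrable setT (fun X => (clamp (f X))%:E).
  move=> mf; apply: measurable_bounded_integrable => //.
  - by rewrite ltey_eq fin_num_measure.
  - exact: (measurableT_comp (@measurable_clamp R)).
  - exists 1; split => //= x x1 X _; apply: le_trans (ltW x1); exact: clamp_norm.
have i1 := bnd _ me; split => //.
have E1 : (\int[nu]_X (clamp (e X))%:E = \int[pushforward nu e]_r (clamp r)%:E)%E.
  by rewrite integral_pushforward.
have E2 : (\int[nu]_X (clamp (- e X))%:E
    = \int[pushforward nu (fun X => (- e X)%R)]_r (clamp r)%:E)%E.
  by rewrite integral_pushforward//; exact: bnd.
have E3 : (\int[nu]_X (clamp (e X))%:E = \int[nu]_X (clamp (- e X))%:E)%E.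
  rewrite E1 E2; apply: eq_measure_integral => S mS _.
  exact: (haar_entry_symmetric R d G nu a b S hG haar mS).
have E4 : (\int[nu]_X (clamp (- e X))%:E = - \int[nu]_X (clamp (e X))%:E)%E.
  rewrite -integralN; last exact: integrable_add_def.
  by apply: eq_integral => X _; rewrite clampN.
move: E3; rewrite E4 -/(e _).
have /fineK <- := integrable_fin_num measurableT i1.
by move=> -[]; rewrite -[fine _]/(fine _) => h; congr (_%:E); lra.
Qed.

(** On [-l, l] the convex exponential lies below its chord, cosh l + y sinh l. Under a centered law
    the linear term disappears and cosh l is left. *)
Lemma expR_le_chord (R : realType) (l y : R) : `|y| <= 1 ->
  expR (l * y) <= (expR l + expR (- l)) / 2 + y * ((expR l - expR (- l)) / 2).
Proof.
rewrite ler_norml => /andP[y1 y2].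
have t01 : 0 <= (1 + y) / 2 <= 1 by apply/andP; split; lra.
have := convex_expR (Itv01 (proj1 (andP t01)) (proj2 (andP t01))) l (- l).
rewrite !convRE /=; set u := expR l; set v := expR (- l) => H.
have -> : l * y = (1 + y) / 2 * l + (1 - (1 + y) / 2) * (- l) by field.
apply: le_trans H _; rewrite /unstable.onem; lra.
Qed.

(** The centered linear part contributes cosh l. The function [h] is room for the error of the net,
    of which only an upper bound is used. *)
Lemma haar_mgf_le (R : realType) (d : nat) (G : set 'M[R]_d)
    (nu : probability (borel_mx R d) R) (L : 'M[R]_d) (h : 'M[R]_d -> R) (l eta : R) :
  G = @orthogonal_group R d \/ (G = @rotation_group R d /\ (1 < d)%N) ->
  haar_law G nu -> 0 <= l -> measurable_fun setT (h : borel_mx R d -> R) ->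
  (forall X : 'M[R]_d, X^T *m X = 1%:M -> `|\tr (L^T *m X)| <= 1 /\ h X <= eta) ->
  (\int[nu]_X (expR (l * (\tr (L^T *m (X : 'M[R]_d)) + h X)))%:E
     <= (expR (l * eta) * ((expR l + expR (- l)) / 2))%:E)%E.
Proof.
move=> hG haar l_ge0 mh Lh.
have GO X : G X -> X^T *m X = 1%:M by case: hG => [->|[-> _] []].
have mG : measurable (G : set (borel_mx R d)).
  by apply: measurable_haar_group; case: hG => [|[]]; auto.
have aeG (Q : set (borel_mx R d)) : (forall X, G X -> Q X) -> {ae nu, forall X, Q X}.
  move=> GQ; exists (~` G); split => //; first exact: measurableC.
    by rewrite probability_setC// haar.1 subee.
  by move=> X /= nQ /GQ.
pose ch := (expR l + expR (- l)) / 2; pose sh := (expR l - expR (- l)) / 2.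
(* A version of the trace that is bounded everywhere, so integrable, and agrees with it on
   orthogonal matrices. *)
pose g (X : 'M[R]_d) := \sum_a \sum_b L a b * clamp (X a b).
have gE X : X^T *m X = 1%:M -> g X = \tr (L^T *m X).
  move=> XX; rewrite /g exchange_big; apply: eq_bigr => b _; rewrite mxE.
  by apply: eq_bigr => a _; rewrite mxE clamp_id// orthogonal_entry.
have mtr : measurable_fun setT (fun X : borel_mx R d => \tr (L^T *m (X : 'M[R]_d))).
  apply: measurable_sumr => b _; under eq_fun do rewrite mxE.
  apply: measurable_sumr => a _; apply: measurable_funM => //.
  exact: measurable_borel_mx_entry.
have mg : measurable_fun setT (g : borel_mx R d -> R).
  apply: measurable_sumr => a _; apply: measurable_sumr => b _.
  apply: measurable_funM => //; apply: (measurableT_comp (@measurable_clamp R)).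
  exact: measurable_borel_mx_entry.
have iclamp a b := haar_clamp_entry R d G nu a b hG haar.
have ig a b : nu.-integrable setT (fun X => (L a b * clamp ((X : 'M[R]_d) a b))%:E).
  by under eq_fun do rewrite EFinM; apply: integrableZl => //; exact: (iclamp a b).1.
have g_int : nu.-integrable setT (fun X : borel_mx R d => (g X)%:E) /\
    (\int[nu]_X (g X)%:E = 0)%E.
  have ga a : nu.-integrable setT (fun X : borel_mx R d =>
      (\sum_b L a b * clamp ((X : 'M[R]_d) a b))%:E).
    by under eq_fun do rewrite -sumEFin; exact: integrable_sum.
  split; first by under eq_fun do rewrite /g -sumEFin; exact: integrable_sum.
  under eq_integral do rewrite /g -sumEFin.
  rewrite integral_sum//= big1// => a _.
  under eq_integral do rewrite -sumEFin.
  rewrite integral_sum//= big1// => b _.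
  under eq_integral do rewrite EFinM.
  by rewrite integralZl//= ?(iclamp a b).2 ?mule0//; exact: (iclamp a b).1.
pose F (X : borel_mx R d) := expR (l * eta) * (ch + sh * g X).
have mF : measurable_fun setT F.
  apply: measurable_funM => //; apply: measurable_funD => //.
  exact: measurable_funM.
have FE X : G X -> expR (l * (\tr (L^T *m X) + h X)) <= F X.
  move=> /GO XX; have [L1 h1] := Lh X XX.
  rewrite mulrDr expRD mulrC; apply: ler_pM; rewrite ?expR_ge0 //.
    by rewrite ler_expR ler_wpM2l.
  by rewrite gE// mulrC [X in _ + X]mulrC; rewrite mulrC expR_le_chord.
(* Outside G the bound F may be negative, while monotonicity is applied to nonnegative integrands.
   Hence the detour through its absolute value, which equals F almost surely. *)
apply: (@le_trans _ _ (\int[nu]_X `|F X|%:E)%E).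
  apply: ae_ge0_le_integral => //.
  - apply/measurable_EFinP; apply: measurableT_comp => //.
    by apply: measurable_funM => //; exact: measurable_funD.
  - by apply/measurable_EFinP; exact: measurableT_comp.
  - apply: aeG => X GX _; rewrite lee_fin.
    by apply: le_trans (FE X GX) _; exact: ler_norm.
rewrite (ae_eq_integral (fun X => (F X)%:E))//; first last.
- apply: aeG => X GX _; rewrite ger0_norm//.
  by apply: le_trans (FE X GX); exact: expR_ge0.
- exact/measurable_EFinP.
- by apply/measurable_EFinP; exact: measurableT_comp.
rewrite /F; under eq_integral do rewrite EFinM.
have i2 : nu.-integrable setT (fun X : borel_mx R d => (ch + sh * g X)%:E).
  under eq_fun do rewrite EFinD; apply: integrableD => //.
    by apply: finite_measure_integrable_cst.
  by under eq_fun do rewrite EFinM; apply: integrableZl => //; exact: g_int.1.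
rewrite integralZl// EFinM.
under eq_integral do rewrite EFinD.
rewrite integralD//=; first last.
- by under eq_fun do rewrite EFinM; apply: integrableZl => //; exact: g_int.1.
- exact: finite_measure_integrable_cst.
have -> : (\int[nu]_X (cst ch%:E X) = ch%:E)%E.
  by rewrite integral_cst//= -[RHS]mule1; congr (_ * _)%E; exact: probability_setT.
under [X in (_ + X)%E]eq_integral do rewrite EFinM.
by rewrite integralZl//= ?g_int.2 ?mule0 ?adde0//; exact: g_int.1.
Qed.

(** * Blocks, rates and union bounds *)

Lemma measurable_mxtrace_mul (dT : measure_display) (T : measurableType dT)
    (R : realType) (d : nat) (B : 'M[R]_d) (F : T -> 'M[R]_d) :
  (forall a b, measurable_fun setT (fun t => F t a b)) ->
  measurable_fun setT (fun t => \tr (B *m F t)).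
Proof.
move=> mF; apply: measurable_sumr => b _; under eq_fun do rewrite mxE.
by apply: measurable_sumr => a _; apply: measurable_funM.
Qed.

Lemma nuclear_norm_ge0 (R : realType) (d : nat) (X : 'M[R]_d) : 0 <= nuclear_norm X.
Proof.
have := trace_contraction_le _ _ 0 X (contractive_mx0 R d).
by rewrite trmx0 mul0mx mxtrace0.
Qed.

(** A pointwise limit of maxima of linear functionals over nets of mesh 1 / (m + 1): each maximum is
    below the norm and misses it by at most the mesh times the entrywise l1 norm. *)
Lemma measurable_nuclear_norm (dT : measure_display) (T : measurableType dT)
    (R : realType) (d : nat) (F : T -> 'M[R]_d) :
  (forall a b, measurable_fun setT (fun t => F t a b)) ->
  measurable_fun setT (fun t => nuclear_norm (F t)).
Proof.
move=> mF.
have /choice[s sP] : forall m : nat, exists s : seq 'M[R]_d,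
    (forall B, B \in s -> contractive_mx B) /\
    forall B, contractive_mx B ->
      exists2 B', B' \in s & forall a b, `|B a b - B' a b| <= m.+1%:R^-1.
  by move=> m; apply: contractive_mx_net; rewrite invr_gt0.
pose f m t := \big[Num.max/0]_(B <- s m) \tr (B^T *m F t).
apply: (@measurable_fun_cvg _ _ _ _ f).
  move=> m; apply: (@measurable_bigop _ _ R Num.max); first exact: measurable_maxr.
  by move=> B _; exact: measurable_mxtrace_mul.
move=> t _; pose c := \sum_a \sum_b `|F t a b|.
have f_le m : f m t <= nuclear_norm (F t).
  rewrite /f big_seq; apply: (big_ind (fun x => x <= nuclear_norm (F t))) => [|x y x1 y1|B Bs].
  - exact: nuclear_norm_ge0.
  - by rewrite ge_max x1.
  - by apply: trace_contraction_le; apply: (sP m).1.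
have f_ge m : nuclear_norm (F t) - m.+1%:R^-1 * c <= f m t.
  have [B Bs BF] := nuclear_norm_le_net _ _ m.+1%:R^-1 (s m) (F t) (sP m).2.
  rewrite lerBlDr (le_trans BF)// lerD2r /f.
  exact: (le_bigmax_seq 0 B xpredT (fun B => \tr (B^T *m F t)) Bs).
apply: (@squeeze_cvgr _ _ _ _ (fun m => nuclear_norm (F t) - m.+1%:R^-1 * c)
   (fun=> nuclear_norm (F t))).
- by apply: nearW => m; rewrite f_ge f_le.
- rewrite -[X in _ --> X]subr0 -[X in _ --> _ - X](mul0r c).
  apply: cvgB; first exact: cvg_cst.
  by apply: cvgMl; exact: cvg_harmonic.
- exact: cvg_cst.
Qed.

Lemma cluster_mxE (R : realType) (n K : nat) (H : 'M[R]_(n, K)) (C : 'I_n -> 'I_K)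
    (i : 'I_n) (j : 'I_K) :
  cluster_mx H -> clustering_of H C -> H i j = (C i == j)%:R.
Proof.
move=> [H01 _ _] HC; have [<-|Cij] := eqVneq (C i) j; first by apply/HC.
by have [//|/HC Cij'] := H01 i j; rewrite Cij' eqxx in Cij.
Qed.

Lemma card_cluster (R : realType) (n K : nat) (H : 'M[R]_(n, K)) (C : 'I_n -> 'I_K) (j : 'I_K) :
  cluster_mx H -> clustering_of H C ->
  #|[set k | C k == j]%SET|%:R = n%:R / K%:R :> R.
Proof.
move=> Hc HC; have [_ _ /rowP/(_ j)] := Hc; rewrite !mxE => <-.
rewrite -sum1_card natr_sum big_mkcond; apply: eq_bigr => k _.
by rewrite mxE (cluster_mxE _ _ _ _ _ _ _ Hc HC) mul1r inE; case: eqP.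
Qed.

Lemma block_mul_assemble (R : realType) (n K d : nat) (A : 'M[R]_(n * d, n * d))
    (X : 'M[R]_(n * d, d)) (H : 'M[R]_(n, K)) (C : 'I_n -> 'I_K) (i : 'I_n) (j : 'I_K) :
  cluster_mx H -> clustering_of H C ->
  block (A *m assemble X H) i j
    = \sum_(k | C k == j) block A i k *m stack_block X k.
Proof.
move=> Hc HC; apply/matrixP => a b; rewrite mxE mxE summxE.
transitivity (\sum_(kc : 'I_n * 'I_d) A (mxtens_index (i, a)) (mxtens_index kc) *
    (assemble X H) (mxtens_index kc) (mxtens_index (j, b))).
  rewrite (reindex (@mxtens_index n d))//.
  by exists (@mxtens_unindex n d) => kc _; rewrite (mxtens_indexK, mxtens_unindexK).
transitivity (\sum_k \sum_c A (mxtens_index (i, a)) (mxtens_index (k, c)) *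
    (assemble X H) (mxtens_index (k, c)) (mxtens_index (j, b))).
  by rewrite pair_bigA; apply: eq_bigr => -[k c].
rewrite [RHS]big_mkcond.
apply: eq_bigr => k _.
have VE c : (assemble X H) (mxtens_index (k, c)) (mxtens_index (j, b))
    = X (mxtens_index (k, c)) b * (C k == j)%:R.
  rewrite mxE castmxE tensmxE [const_mx _ _ _]mxE mulr1 cast_ord_id.
  have -> : cast_ord (esym (mul1n (n * d))) (mxtens_index (k, c))
      = mxtens_index (0, mxtens_index (k, c)).
    by apply: val_inj; rewrite /= mul0n.
  by rewrite tensmxE [const_mx _ _ _]mxE mul1r (cluster_mxE _ _ _ _ _ _ _ Hc HC).
case: eqP VE => _ VE; last first.
  by rewrite big1// => c _; rewrite VE mulr0 mulr0.
by rewrite mxE; apply: eq_bigr => c _; rewrite VE mulr1 !mxE.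
Qed.

(** The factor e inside the logarithm splits off a summand s, and log (alpha / s) > 0 because s <
    alpha. *)
Lemma separation_gap (R : realType) (alpha s K : R) :
  0 < alpha -> 0 < s -> 0 < K -> s < alpha ->
  K < alpha - s * ln (expR 1 * alpha / s) ->
  s + K < alpha /\ K < alpha - s - s * ln (alpha / s).
Proof.
move=> a0 s0 K0 sa; rewrite -mulrA lnM ?posrE ?expR_gt0 ?divr_gt0// expRK.
have ln_gt0 : 0 < ln (alpha / s) by rewrite ln_gt0// ltr_pdivlMr// mul1r.
have : 0 < s * ln (alpha / s) by rewrite mulr_gt0.
rewrite mulrDr mulr1; split; lra.
Qed.

(* With [expR l = 1 + 2 * K / s] the rate equals
   [K + 2 * K * (alpha - s - K) / (s + 2 * K)]. *)
Lemma joint_rate_gt (R : realType) (alpha beta s K : R) :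
  0 < s -> 0 < K -> s ^+ 2 = 2 * K * beta -> s + K < alpha ->
  let l := ln (1 + 2 * K / s) in
  0 < l /\
  K < alpha * (1 - expR (- l)) - beta * ((expR l + expR (- l)) / 2 - 1).
Proof.
move=> s0 K0 sE sK l.
have e1 : 1 < 1 + 2 * K / s by rewrite ltrDl divr_gt0// mulr_gt0.
split; first by rewrite ln_gt0.
rewrite expRN /l lnK ?posrE ?(lt_trans ltr01)//.
have -> : beta = s ^+ 2 / (2 * K) by rewrite sE; field; exact: lt0r_neq0.
have sK2 : 0 < s + 2 * K by lra.
rewrite -subr_gt0 [X in 0 < X](_ : _ = 2 * K * (alpha - s - K) / (s + 2 * K)).
  by rewrite divr_gt0// mulr_gt0//; lra.
by field; rewrite !lt0r_neq0//=; lra.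
Qed.

(** Of the gap e, the separation [chi] spends a quarter and the net error [eta] a half: exp (l eta)
    = 1 + x with B ch x = e / 2. *)
Lemma perturbed_rate (R : realType) (A B K l ch : R) :
  0 < A -> 0 < B -> 0 < l -> 0 < ch -> K < A - B * (ch - 1) ->
  exists chi eta, [/\ 0 < chi, 0 < eta & K < A - l * chi - B * (expR (l * eta) * ch - 1)].
Proof.
move=> A0 B0 l0 ch0 gap; pose e := A - B * (ch - 1) - K.
have e0 : 0 < e by rewrite /e; lra.
pose x := e / (2 * B * ch).
have x0 : 0 < x by rewrite divr_gt0// !mulr_gt0.
exists (e / (4 * l)), (ln (1 + x) / l); split.
- by rewrite divr_gt0// mulr_gt0.
- by rewrite divr_gt0// ln_gt0// ltrDl.
rewrite [l * (ln _ / l)]mulrC divfK ?lt0r_neq0// lnK ?posrE ?addr_gt0//.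
have -> : l * (e / (4 * l)) = e / 4 by field; exact: lt0r_neq0.
have -> : B * ((1 + x) * ch - 1) = B * (ch - 1) + e / 2.
  by rewrite /x; field; rewrite !lt0r_neq0.
move: (e0); rewrite {1}/e; rewrite /e; lra.
Qed.

(** With r the square root of n, log n = 2 log r <= 2 r, and 2 a <= r eventually. It makes p and q
    probabilities. *)
Lemma ln_div_le1 (R : realType) (a : R) : 0 < a ->
  \forall n \near \oo, a * ln n%:R / n%:R <= 1.
Proof.
move=> a0; near=> n.
have n0 : 0 < n%:R :> R by rewrite ltr0n; near: n; exact: nbhs_infty_gt.
have an : (2 * a) ^+ 2 <= n%:R by near: n; exact: nbhs_infty_ger.
rewrite ler_pdivrMr// mul1r; set r : R := Num.sqrt n%:R.
have r0 : 0 < r by rewrite sqrtr_gt0.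
have nE : n%:R = r ^+ 2 by rewrite sqr_sqrtr// ltW.
have ar : 2 * a <= r.
  have a2 : 0 <= 2 * a by rewrite mulr_ge0// ltW.
  by rewrite -(ger0_norm a2) -sqrtr_sqr; exact: ler_wsqrtr.
rewrite nE lnXn// mulrnAr mulr2n.
have lnr : ln r <= r by exact/ltW/ln_sublinear.
nra.
Unshelve. all: by end_near. Qed.

Lemma adapted_RV (dT : measure_display) (T : measurableType dT) (R : realType)
    (P : probability T R) (d' : measure_display) (T' : measurableType d')
    (X : {RV P >-> T'}) (g : T' -> R) :
  measurable_fun setT g -> (forall x, 0 <= g x) ->
  (\int[distribution P X]_x (g x)%:E < +oo)%E ->
  adapted P (g_sigma_algebra_preimage X) (fun t => g (X t)) /\
  (\int[P]_t (g (X t))%:E = \int[distribution P X]_x (g x)%:E)%E.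
Proof.
move=> mg g0 gfin.
have E : (\int[P]_t (g (X t))%:E = \int[distribution P X]_x (g x)%:E)%E.
  by rewrite ge0_integral_distribution//; exact/measurable_EFinP.
split=> //; split => //.
- exact: measurableT_comp.
- by rewrite E ge0_fin_numE// integral_ge0// => y _; rewrite lee_fin.
- move=> B mB; exists (g @^-1` B); last by rewrite setTI.
  by rewrite -[X in measurable X]setTI; exact: mg.
Qed.

Lemma adapted_bernoulli (dT : measure_display) (T : measurableType dT) (R : realType)
    (P : probability T R) (X : {RV P >-> bool}) (p : R) (g : bool -> R) :
  0 <= p <= 1 -> distribution P X = bernoulli_prob p -> (forall x, 0 <= g x) ->
  adapted P (g_sigma_algebra_preimage X) (fun t => g (X t)) /\
  (\int[P]_t (g (X t))%:E = (p * g true + (1 - p) * g false)%:E)%E.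
Proof.
move=> p01 Xp g0.
have E : (\int[distribution P X]_x (g x)%:E = (p * g true + (1 - p) * g false)%:E)%E.
  by rewrite Xp integral_bernoulli_prob// => y; rewrite lee_fin.
have [|//|//|] := @adapted_RV _ _ _ P _ _ X g; first by [].
  by rewrite E ltry.
by rewrite E.
Qed.

Lemma measure_exists_mem_le (dT : measure_display) (T : measurableType dT) (R : realType)
    (P : probability T R) (I : eqType) (s : seq I) (E : I -> set T) (e : R) :
  (forall i, i \in s -> measurable (E i) /\ (P (E i) <= e%:E)%E) ->
  measurable [set t | exists2 i, i \in s & E i t] /\
  (P [set t | exists2 i, i \in s & E i t] <= ((size s)%:R * e)%:E)%E.
Proof.
elim: s => [|i s IHs] HE.
  have -> : [set t | exists2 i, i \in [::] & E i t] = set0.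
    by apply/seteqP; split => t // [].
  by rewrite measure0 mul0r.
have [|ms Ps] := IHs; first by move=> j js; apply: HE; rewrite inE js orbT.
have [mi Pi] := HE i (mem_head _ _).
have -> : [set t | exists2 j, j \in i :: s & E j t]
    = E i `|` [set t | exists2 j, j \in s & E j t].
  apply/seteqP; split => t /=.
    by move=> [j]; rewrite inE => /orP[/eqP ->|js] Ej; [left|right; exists j].
  by case=> [Ei|[j js Ej]]; [exists i => //; exact: mem_head|exists j => //; rewrite inE js orbT].
split; first exact: measurableU.
apply: le_trans (measureU2 _ _ _) _ => //.
by rewrite -natr1 mulrDl mul1r addrC EFinD leeD.
Qed.

(** Markov's inequality at level 1; in the Chernoff bound the threshold is absorbed into [V]. *)
Lemma measure_le_integral (dT : measure_display) (T : measurableType dT) (R : realType)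
    (P : probability T R) (V : T -> R) :
  measurable_fun setT V -> (forall t, 0 <= V t) ->
  measurable [set t | 1 <= V t] /\ (P [set t | 1 <= V t]%R <= \int[P]_t (V t)%:E)%E.
Proof.
move=> mV V0.
have mE : measurable [set t | 1 <= V t].
  rewrite (_ : [set t | _] = setT `&` V @^-1` `[1, +oo[); first exact: mV.
  by apply/seteqP; split => t /=; rewrite in_itv/= andbT //; case.
split => //.
have <- : (\int[P]_t (\1_[set t | (1 <= V t)%R] t)%:E = P [set t | (1 <= V t)%R])%E.
  by rewrite integral_indic// setIT.
apply: ge0_le_integral => //.
- exact/measurable_EFinP.
- exact/measurable_EFinP.
- move=> t _; rewrite lee_fin indicE; case: (asboolP ([set t | 1 <= V t] t)) => h.
    by rewrite mem_set.
  by rewrite memNset.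
Qed.

(** * Tail bounds for the block model *)

(* If [B] ranges over an [e]-net of the contractions, then the maximum of
   [d%:R * test_value B e Q] dominates the nuclear norm of [Q]. *)
Definition test_value {R : realType} {d : nat} (B : 'M[R]_d) (e : R) (Q : 'M[R]_d) : R :=
  (\tr (B^T *m Q) + e * (\sum_a \sum_b `|Q a b|)) / d%:R.

Lemma measurable_test_value (dT : measure_display) (T : measurableType dT)
    (R : realType) (d : nat) (B : 'M[R]_d) (e : R) (F : T -> 'M[R]_d) :
  (forall a b, measurable_fun setT (fun t => F t a b)) ->
  measurable_fun setT (fun t => test_value B e (F t)).
Proof.
move=> mF; apply: measurable_funM => //; apply: measurable_funD.
  exact: measurable_mxtrace_mul.
apply: measurable_funM => //; apply: measurable_sumr => a _.
by apply: measurable_sumr => b _; exact: measurableT_comp.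
Qed.

(** Seen from one agent, the noise towards another is the sampled rotation or its transpose,
    depending on which index is smaller. *)
Definition oriented {R : realType} {d : nat} (o : bool) (X : 'M[R]_d) : 'M[R]_d :=
  if o then X else X^T.

Lemma measurable_oriented_mul (R : realType) (d : nat) (Y : 'M[R]_d) (o : bool) (a b : 'I_d) :
  measurable_fun setT (fun X : borel_mx R d => (oriented o (X : 'M[R]_d) *m Y) a b).
Proof.
under eq_fun do rewrite mxE; apply: measurable_sumr => k _.
apply: measurable_funM => //; case: o => /=; first exact: measurable_borel_mx_entry.
by under eq_fun do rewrite mxE; exact: measurable_borel_mx_entry.
Qed.

(** By cyclicity of the trace, [Y] and the transposition move onto the test matrix, so both
    orientations become linear functionals of X and left invariance suffices. The d^2 entries, each
    at most 1 in absolute value, give the error e d^2 / d. *)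
Lemma noise_mgf_le (R : realType) (d : nat) (G : set 'M[R]_d)
    (nu : probability (borel_mx R d) R) (B Y : 'M[R]_d) (o : bool) (l e : R) :
  (0 < d)%N ->
  G = @orthogonal_group R d \/ (G = @rotation_group R d /\ (1 < d)%N) ->
  haar_law G nu -> 0 <= l -> 0 <= e -> contractive_mx B -> Y^T *m Y = 1%:M ->
  (\int[nu]_X (expR (l * test_value B e (oriented o (X : 'M[R]_d) *m Y)))%:E
     <= (expR (l * (e * d%:R)) * ((expR l + expR (- l)) / 2))%:E)%E.
Proof.
move=> d_gt0 hG haar l0 e0 Bc YY.
have d0 : 0 < d%:R :> R by rewrite ltr0n.
have YY' : Y *m Y^T = 1%:M by exact: mulmx1C.
pose L := d%:R^-1 *: (if o then B *m Y^T else Y *m B^T).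
pose h (X : 'M[R]_d) := e * (\sum_a \sum_b `|(oriented o X *m Y) a b|) / d%:R.
have LE (X : 'M[R]_d) : \tr (L^T *m X) = \tr (B^T *m (oriented o X *m Y)) / d%:R.
  have -> : L^T = d%:R^-1 *: (if o then Y *m B^T else B *m Y^T).
    apply/matrixP => a b; rewrite /L mxE; case: (o).
      by rewrite -[in RHS](trmxK Y) -trmx_mul !mxE.
    by rewrite -[in RHS](trmxK B) -trmx_mul !mxE.
  rewrite -scalemxAl mxtraceZ mulrC; congr (_ / _); rewrite /oriented; case: (o).
    by rewrite -mulmxA mxtrace_mulC mulmxA.
  rewrite -[RHS]mxtrace_tr !trmx_mul !trmxK.
  by rewrite [RHS]mxtrace_mulC mulmxA.
have tvE X : test_value B e (oriented o X *m Y) = \tr (L^T *m X) + h X.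
  by rewrite LE /test_value mulrDl.
under eq_integral do rewrite tvE.
apply: (haar_mgf_le _ _ _ _ _ _ _ _ hG haar l0).
  apply: measurable_funM => //; apply: measurable_funM => //.
  apply: measurable_sumr => a _; apply: measurable_sumr => b _.
  by apply: measurableT_comp => //; exact: measurable_oriented_mul.
move=> X XX; have XX' : X *m X^T = 1%:M by exact: mulmx1C.
have QQ : (oriented o X *m Y)^T *m (oriented o X *m Y) = 1%:M.
  rewrite trmx_mul mulmxA -(mulmxA Y^T); case: (o); first by rewrite XX mulmx1.
  by rewrite /oriented trmxK XX' mulmx1.
split.
  rewrite LE normrM normfV [`|d%:R|]gtr0_norm// ler_pdivrMr// mul1r.
  exact: trace_contraction_orthogonal.
rewrite /h ler_pdivrMr// -mulrA ler_wpM2l//.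
apply: (@le_trans _ _ (\sum_(a < d) \sum_(b < d) 1)).
  by apply: ler_sum => a _; apply: ler_sum => b _; exact: orthogonal_entry.
by under eq_bigr do rewrite sumr_const card_ord; rewrite sumr_const card_ord -mulrnA natrM.
Qed.

(* Only the pairs [(i, k)] with [i < k] are sampled: block [(k, i)] is the
   transpose of block [(i, k)]. *)
Definition edge {n : nat} (i k : 'I_n) : 'I_n * 'I_n :=
  if (i < k)%N then (i, k) else (k, i).

Lemma edge_inj (n : nat) (i : 'I_n) : injective (edge i).
Proof.
move=> k k'; rewrite /edge; case: ifPn => ik; case: ifPn => ik' [] //.
  by move=> ik'' ki; move: ik; rewrite ki ltnn.
by move=> ki ik''; move: ik'; rewrite -ik'' ltnn.
Qed.

Lemma edge_lt (n : nat) (i k : 'I_n) : k != i -> ((edge i k).1 < (edge i k).2)%N.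
Proof.
move=> ki; rewrite /edge; case: (ltnP i k) => //= ki'.
by rewrite ltn_neqAle ki' andbT.
Qed.

Lemma edge_sym (n K : nat) (C : 'I_n -> 'I_K) (i k : 'I_n) :
  (C (edge i k).1 == C (edge i k).2) = (C k == C i).
Proof. by rewrite /edge; case: ifP => //=; rewrite eq_sym. Qed.

Lemma lee_prod_const (R : realType) (I : eqType) (s : seq I) (g : I -> \bar R) (h : R) :
  0 <= h -> (forall k, k \in s -> 0 <= g k <= h%:E)%E ->
  (0 <= \prod_(k <- s) g k <= (h ^+ size s)%:E)%E.
Proof.
move=> h0; elim: s => [|k s IHs] gh; first by rewrite big_nil lee01 /= lexx.
have /andP[s0 sh] := IHs (fun j js => gh j (mem_behead (s := k :: s) js)).
have /andP[k0 kh] := gh k (mem_head _ _).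
by rewrite big_cons mule_ge0//= exprS EFinM lee_pmul.
Qed.

Section chernoff.
Context {dT : measure_display} {T : measurableType dT} {R : realType}
  {P : probability T R} {n K d : nat} {p q : R} {G : set 'M[R]_d}
  (Xs : 'M[R]_(n * d, d)) (C : 'I_n -> 'I_K)
  (w u : 'I_n -> 'I_n -> {RV P >-> bool})
  (N : 'I_n -> 'I_n -> {RV P >-> borel_mx R d})
  {A : T -> 'M[R]_(n * d, n * d)}
  (model : sgbm_with p q G Xs C w u N A) (d_gt0 : (0 < d)%N)
  (hG : G = @orthogonal_group R d \/ (G = @rotation_group R d /\ (1 < d)%N))
  (Xs_G : stacks G Xs).

Definition within_edge (i k : 'I_n) (t : T) : R := (w (edge i k).1 (edge i k).2 t)%:R.
Definition across_edge (i k : 'I_n) (t : T) : R := (u (edge i k).1 (edge i k).2 t)%:R.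
Definition noise_mx (i k : 'I_n) (t : T) : 'M[R]_d :=
  oriented (i < k)%N (N (edge i k).1 (edge i k).2 t : 'M[R]_d) *m stack_block Xs k.
Definition signal (i : 'I_n) (t : T) : R :=
  \sum_(k | (k != i) && (C k == C i)) within_edge i k t.
Definition noise_value (B : 'M[R]_d) (e : R) (i : 'I_n) (S : seq 'I_n) (t : T) : R :=
  \sum_(k <- S) across_edge i k t * test_value B e (noise_mx i k t).

Lemma stack_block_orthogonal k : (stack_block Xs k)^T *m stack_block Xs k = 1%:M.
Proof. by have := Xs_G k; case: hG => [->|[-> _] []]. Qed.

(** By independence the expectation is a product over agents, with factors 1 + p (exp (- l) - 1)
    inside the cluster and at most 1 + q (M - 1) outside, M bounding the transform of one noise
    term; then 1 + x <= exp x. *)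
Lemma signal_noise_mgf (i : 'I_n) (S : seq 'I_n) (B : 'M[R]_d) (l e : R) :
  0 <= p <= 1 -> 0 <= q <= 1 -> 0 <= l -> 0 <= e -> contractive_mx B ->
  uniq S -> (forall k, k \in S -> C k != C i) ->
  let V t := expR (l * (noise_value B e i S t - signal i t)) in
  measurable_fun setT V /\
  (\int[P]_t (V t)%:E <=
    (expR (#|[set k | (k != i) && (C k == C i)]%SET|%:R * (p * (expR (- l) - 1)) +
      (size S)%:R * (q * (expR (l * (e * d%:R)) * ((expR l + expR (- l)) / 2) - 1))))%:E)%E.
Proof.
move=> p01 q01 l0 e0 Bc S_uniq SC V.
pose F := sgbm_sigma C w u N.
pose x (k : 'I_n) : ('I_n * 'I_n) + ('I_n * 'I_n) := inl (edge i k).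
pose y (k : 'I_n) : ('I_n * 'I_n) + ('I_n * 'I_n) := inr (edge i k).
pose a (k : 'I_n) t : R := (~~ u (edge i k).1 (edge i k).2 t)%:R.
pose b (k : 'I_n) t : R := across_edge i k t.
pose c (k : 'I_n) t : R := expR (l * test_value B e (noise_mx i k t)).
pose f (z : ('I_n * 'I_n) + ('I_n * 'I_n)) t : R :=
  match z with inl (k1, k2) => expR (- l * (w k1 k2 t)%:R) | inr _ => 1 end.
pose M := expR (l * (e * d%:R)) * ((expR l + expR (- l)) / 2).
pose A0 := [set k | (k != i) && (C k == C i)]%SET.
pose J := [set x k | k in A0]%SET.
have x_inj : injective x by move=> k k' [] /edge_inj.
have y_inj : injective y by move=> k k' [] /edge_inj.
have M0 : 0 <= M by rewrite mulr_ge0 ?expR_ge0// divr_ge0// addr_ge0 ?expR_ge0.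
have ki k : k \in S -> k != i by move=> /SC; apply: contraNneq => ->.
have CS k : k \in S -> C k == C i = false by move=> /SC /negbTE.
have FT z : z \in sgbm_indices C -> F z `<=` measurable.
  have mRV d' (T' : measurableType d') (X : {RV P >-> T'}) :
      g_sigma_algebra_preimage X `<=` measurable.
    by move=> _ [E mE <-]; exact: (measurable_funPT X).
  by move=> _; case: z => -[k1 k2]; rewrite /F /=; [case: ifP => _; exact: mRV|exact: mRV].
have fJ k : k \in A0 -> adapted P (F (x k)) (f (x k)) /\
    (\int[P]_t (f (x k) t)%:E = (1 + p * (expR (- l) - 1))%:E)%E.
  rewrite inE => /andP[ik Ck]; have lt := edge_lt _ _ _ ik; have Ce := edge_sym n K C i k.
  rewrite Ck in Ce; move: lt Ce; rewrite /F /x; case: (edge i k) => k1 k2 /= lt Ce.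
  rewrite Ce; have [ad ->] := adapted_bernoulli _ _ _ _ _ p (fun v : bool => expR (- l * v%:R))
    p01 (sgbm_within_law model lt (eqP Ce)) (fun _ => expR_ge0 _).
  by split => //; rewrite mulr1 mulr0 expR0; congr (_%:E); ring.
have abS k : k \in S -> [/\ adapted P (F (x k)) (a k), adapted P (F (x k)) (b k),
    (\int[P]_t (a k t)%:E = (1 - q)%:E)%E & (\int[P]_t (b k t)%:E = q%:E)%E].
  move=> kS; have lt := edge_lt _ _ _ (ki k kS); have Ce := edge_sym n K C i k.
  rewrite (CS k kS) in Ce; move: lt Ce; rewrite /F /x /a /b /across_edge.
  case: (edge i k) => k1 k2 /= lt Ce; rewrite Ce.
  have Cn : C k1 <> C k2 by apply/eqP; rewrite Ce.
  have [ad1 ->] := adapted_bernoulli _ _ _ _ _ q (fun v : bool => (~~ v)%:R)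
    q01 (sgbm_across_law model lt Cn) (fun _ => ler0n _ _).
  have [ad2 ->] := adapted_bernoulli _ _ _ _ _ q (fun v : bool => v%:R)
    q01 (sgbm_across_law model lt Cn) (fun _ => ler0n _ _).
  by split => //=; congr (_%:E); ring.
have cS k : k \in S -> adapted P (F (y k)) (c k) /\ (\int[P]_t (c k t)%:E <= M%:E)%E.
  move=> kS; have lt := edge_lt _ _ _ (ki k kS); have Ce := edge_sym n K C i k.
  rewrite (CS k kS) in Ce; move: lt Ce; rewrite /F /y /c /noise_mx.
  case: (edge i k) => k1 k2 /= lt Ce.
  have Cn : C k1 <> C k2 by apply/eqP; rewrite Ce.
  have le := noise_mgf_le _ _ _ (distribution P (N k1 k2)) B (stack_block Xs k) (i < k)%N
    l e d_gt0 hG (sgbm_noise_law model lt Cn) l0 e0 Bc (stack_block_orthogonal k).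
  have [|||ad ->] := adapted_RV _ _ _ P _ _ (N k1 k2)
     (fun X => expR (l * test_value B e (oriented (i < k)%N (X : 'M[R]_d) *m stack_block Xs k))).
  - apply: measurableT_comp => //; apply: measurable_funM => //.
    by apply: measurable_test_value => k3 k4; exact: measurable_oriented_mul.
  - by move=> X; exact: expR_ge0.
  - by apply: le_lt_trans le _; rewrite ltry.
  by split.
have VE t : V t = \prod_(z in J) f z t * \prod_(k <- S) (a k t + b k t * c k t).
  rewrite /V mulrBr addrC expRD; congr (_ * _).
    rewrite /J big_imset/=; last by move=> k k' _ _; exact: x_inj.
    rewrite /signal mulr_sumr -sumrN expR_sum; apply: eq_big => [k|k _]; first by rewrite inE.
    by rewrite /f /x /within_edge -mulNr; case: (edge i k).
  rewrite /noise_value mulr_sumr expR_sum; apply: eq_bigr => k _.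
  rewrite /a /b /c /across_edge; case: (u _ _ t).
    by rewrite /= !mul1r add0r.
  by rewrite /= !mul0r mulr0 expR0 addr0.
have mV : measurable_fun setT V.
  rewrite (funext VE); apply: measurable_funM.
    by apply: measurable_prodr => z /imsetP[k /fJ[[mf _ _ _] _] ->].
  under eq_fun do rewrite big_seq.
  apply: measurable_prodr => k kS; have [[ma _ _ _] [mb _ _ _] _ _] := abS k kS.
  have [[mc _ _ _] _] := cS k kS.
  by apply: measurable_funD => //; exact: measurable_funM.
split => //; under eq_integral do rewrite VE.
rewrite (@integral_prod_indep_mix _ _ _ _ _ (sgbm_indices C) F _ x y)//; first last.
- move=> k kS; have lt := edge_lt _ _ _ (ki k kS); have Ce := edge_sym n K C i k.
  rewrite (CS k kS) in Ce; have [ak bk _ _] := abS k kS; have [ck _] := cS k kS.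
  have xyD : (x k \in sgbm_indices C) && (y k \in sgbm_indices C).
    by move: lt Ce; rewrite /x /y; case: (edge i k) => k1 k2 /= lt Ce; rewrite !inE lt Ce.
  have /andP[xD yD] := xyD.
  have xJ : x k \notin J.
    apply/imsetP => -[k' + /x_inj kk']; rewrite -kk' inE (CS k kS) andbF//.
  have yJ : y k \notin J by apply/imsetP => -[k' _].
  by split => //; rewrite inE ?xJ ?yJ.
- by move=> z /imsetP[k /fJ[ad _] ->].
- apply/fintype.subsetP => z /imsetP[k + ->]; rewrite inE => /andP[ik _].
  have := edge_lt _ _ _ ik; rewrite /x; case: (edge i k) => k1 k2 /= lt.
  by rewrite inE.
- exact: (sgbm_independent model).
have /andP[p0 p1] := p01; have /andP[q0 q1] := q01.
have fE : (\prod_(z in J) \int[P]_t (f z t)%:E)%E = ((1 + p * (expR (- l) - 1)) ^+ #|A0|)%:E.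
  rewrite /J big_imset/=; last by move=> k k' _ _; exact: x_inj.
  rewrite (eq_bigr (fun=> (1 + p * (expR (- l) - 1))%:E)); last by move=> k /fJ[].
  by rewrite prodEFin prodr_const.
rewrite fE expRD EFinM.
have sub0 : 0 <= 1 + p * (expR (- l) - 1) by have := expR_ge0 (- l); nra.
have q0' : 0 <= 1 + q * (M - 1) by nra.
have /andP[s0 s1] : (0 <= \prod_(k <- S) (\int[P]_t (a k t)%:E +
    \int[P]_t (b k t)%:E * \int[P]_t (c k t)%:E) <= ((1 + q * (M - 1)) ^+ size S)%:E)%E.
  apply: lee_prod_const => // k kS; have [_ _ -> ->] := abS k kS; have [[_ c0 _ _] cM] := cS k kS.
  have c0' : (0 <= \int[P]_t (c k t)%:E)%E by apply: integral_ge0 => t _; rewrite lee_fin.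
  rewrite adde_ge0 ?mule_ge0 ?lee_fin ?subr_ge0//=.
  rewrite (_ : 1 + q * (M - 1) = (1 - q) + q * M); last by ring.
  by rewrite [leRHS]EFinD (EFinM q) leeD2l// lee_wpmul2l.
apply: lee_pmul => //; first by rewrite lee_fin exprn_ge0.
  rewrite lee_fin [X in _ <= expR X]mulrC expRM_natr; apply: lerXn2r; rewrite ?nnegrE ?expR_ge0//.
  exact: expR_ge1Dx.
apply: le_trans s1 _; rewrite lee_fin [X in _ <= expR X]mulrC expRM_natr.
by apply: lerXn2r; rewrite ?nnegrE ?expR_ge0//; exact: expR_ge1Dx.
Qed.

(** Chernoff's bound for the difference of signal and noise, with a single tilt [l] for both. *)
Lemma signal_noise_tail (i : 'I_n) (S : seq 'I_n) (B : 'M[R]_d) (l e x : R) :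
  0 <= p <= 1 -> 0 <= q <= 1 -> 0 < l -> 0 <= e -> contractive_mx B ->
  uniq S -> (forall k, k \in S -> C k != C i) ->
  let E := [set t | signal i t - noise_value B e i S t <= x] in
  measurable E /\
  (P E <= (expR (l * x + (#|[set k | (k != i) && (C k == C i)]%SET|%:R * (p * (expR (- l) - 1)) +
      (size S)%:R * (q * (expR (l * (e * d%:R)) * ((expR l + expR (- l)) / 2) - 1)))))%:E)%E.
Proof.
move=> p01 q01 l_gt0 e0 Bc S_uniq SC E.
have [mV V_le] := signal_noise_mgf i S B l e p01 q01 (ltW l_gt0) e0 Bc S_uniq SC.
set V := (fun t => _) in mV V_le.
have mW : measurable_fun setT (fun t => expR (l * x) * V t) by exact: measurable_funM.
have W0 t : 0 <= expR (l * x) * V t by rewrite mulr_ge0 ?expR_ge0.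
have -> : E = [set t | 1 <= expR (l * x) * V t].
  apply/seteqP; split => t; rewrite /E /V /= -expRD -mulrDr -[X in X <= expR _]expR0 ler_expR.
    by move=> h; rewrite mulr_ge0 ?(ltW l_gt0)//; lra.
  by rewrite pmulr_rge0//; lra.
have [mE PE] := measure_le_integral _ _ _ P _ mW W0; split => //.
apply: le_trans PE _; rewrite expRD EFinM.
under eq_integral do rewrite EFinM.
rewrite ge0_integralZl_EFin ?expR_ge0//.
- by rewrite lee_wpmul2l// lee_fin expR_ge0.
- by move=> t _; rewrite lee_fin expR_ge0.
- exact/measurable_EFinP.
Qed.

Lemma block_sym (i k : 'I_n) (t : T) : block (A t) k i = (block (A t) i k)^T.
Proof.
apply/matrixP => a b; rewrite !mxE -[in RHS](sgbm_symmetric model t).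
by rewrite [RHS]mxE.
Qed.

(** The rotation of agent k cancels, so all observed edges inside the cluster contribute the same
    matrix and their counts add up. *)
Lemma block_within (i k : 'I_n) (t : T) : k != i -> C k = C i ->
  block (A t) i k *m stack_block Xs k = within_edge i k t *: stack_block Xs i.
Proof.
move=> ki Cki; rewrite /within_edge /edge; case: (ltnP i k) => ik /=.
  rewrite (sgbm_within model)// -scalemxAl -mulmxA stack_block_orthogonal.
  by rewrite mulmx1.
have {}ik : (k < i)%N by rewrite ltn_neqAle ik andbT.
rewrite block_sym (sgbm_within model)// linearZ/= trmx_mul trmxK -scalemxAl.
by rewrite -mulmxA stack_block_orthogonal mulmx1.
Qed.

Lemma block_across (i k : 'I_n) (t : T) : C k != C i ->
  block (A t) i k *m stack_block Xs k = across_edge i k t *: noise_mx i k t.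
Proof.
move=> Cki; rewrite /across_edge /noise_mx /edge; case: (ltnP i k) => ik /=.
  by rewrite (sgbm_across model) ?scalemxAl//; apply/eqP; rewrite eq_sym.
have {}ik : (k < i)%N.
  by rewrite ltn_neqAle ik andbT; apply: contraNneq Cki => /val_inj ->.
rewrite block_sym (sgbm_across model) ?linearZ/= -?scalemxAl//.
exact/eqP.
Qed.

Context (Hs : 'M[R]_(n, K)) (Hs_cluster : cluster_mx Hs) (HC : clustering_of Hs C).

Lemma signal_block (i : 'I_n) (t : T) :
  block (A t *m assemble Xs Hs) i (C i) = (1 + signal i t) *: stack_block Xs i.
Proof.
rewrite (block_mul_assemble _ _ _ _ _ _ _ C)// (bigD1 i)//=.
rewrite (sgbm_diagonal model) mul1mx scalerDl scale1r; congr (_ + _).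
rewrite /signal scaler_suml; apply: eq_big => [k|k /andP[/eqP Ck ki]].
  by rewrite andbC.
exact: block_within.
Qed.

Lemma noise_block (i : 'I_n) (j : 'I_K) (t : T) : j != C i ->
  block (A t *m assemble Xs Hs) i j =
    \sum_(k | C k == j) across_edge i k t *: noise_mx i k t.
Proof.
move=> ji; rewrite (block_mul_assemble _ _ _ _ _ _ _ C)//.
by apply: eq_bigr => k /eqP Ck; rewrite block_across// Ck.
Qed.

(** One net element tests the whole sum, linearly in the noise terms; only the error part is split
    by the triangle inequality. *)
Lemma noise_nuclear_norm_le (i : 'I_n) (j : 'I_K) (t : T) (e : R) (s : seq 'M[R]_d) :
  0 <= e -> j != C i ->
  (forall B, contractive_mx B ->
      exists2 B', B' \in s & forall a b, `|B a b - B' a b| <= e) ->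
  exists2 B, B \in s & nuclear_norm (block (A t *m assemble Xs Hs) i j)
    <= d%:R * noise_value B e i (enum [set k | C k == j]%SET) t.
Proof.
move=> e0 ji net; set X := block _ _ _.
have [B Bs BX] := nuclear_norm_le_net _ _ e s X net; exists B => //.
apply: le_trans BX _; have XE := noise_block i j t ji.
have across0 k : 0 <= across_edge i k t by exact: ler0n.
rewrite /noise_value mulr_sumr big_enum_cond/=.
rewrite (eq_bigl (fun k => C k == j)); last by move=> k; rewrite inE andbT.
have dE k : d%:R * (across_edge i k t * test_value B e (noise_mx i k t)) =
    across_edge i k t * \tr (B^T *m noise_mx i k t) +
    e * (across_edge i k t * \sum_a \sum_b `|noise_mx i k t a b|).
  by rewrite /test_value; field; rewrite pnatr_eq0 -lt0n.
rewrite (eq_bigr _ (fun k _ => dE k)).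
rewrite big_split/= -mulr_sumr; apply: lerD.
  rewrite /X XE mulmx_sumr raddf_sum/=; apply: ler_sum => k _.
  by rewrite -scalemxAr mxtraceZ.
rewrite ler_wpM2l//; under [leRHS]eq_bigr do rewrite mulr_sumr.
rewrite [leRHS]exchange_big/=; apply: ler_sum => a _.
under [leRHS]eq_bigr do rewrite mulr_sumr.
rewrite [leRHS]exchange_big/=; apply: ler_sum => b _.
rewrite /X XE summxE; apply: le_trans (ler_norm_sum _ _ _) _.
by apply: ler_sum => k _; rewrite mxE normrM ger0_norm.
Qed.

(** Measurability of [A] is not part of the model; it is recovered from the edge variables and noise
    rotations. *)
Lemma measurable_block_entry (i k : 'I_n) (a b : 'I_d) :
  measurable_fun setT (fun t => block (A t) i k a b).
Proof.
have mB (X : {RV P >-> bool}) : measurable_fun setT (fun t => (X t)%:R : R).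
  by apply: (measurableT_comp (f := fun v : bool => v%:R : R)).
have lt (i' k' : 'I_n) a' b' : (i' < k')%N ->
    measurable_fun setT (fun t => block (A t) i' k' a' b').
  move=> ik; have [Cik|/eqP Cik] := eqVneq (C i') (C k').
    under eq_fun do rewrite (sgbm_within model)// mxE.
    exact: measurable_funM.
  under eq_fun do rewrite (sgbm_across model)// mxE.
  apply: measurable_funM => //.
  apply: (measurableT_comp (measurable_borel_mx_entry R d a' b')) => //.
have [ik|ki|/val_inj ->] := ltngtP i k; first exact: lt.
  by under eq_fun do rewrite block_sym mxE; exact: lt.
by under eq_fun do rewrite (sgbm_diagonal model); exact: measurable_cst.
Qed.

Lemma measurable_mu_mx (i : 'I_n) (j : 'I_K) :
  measurable_fun setT (fun t => mu_mx (A t *m assemble Xs Hs) i j).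
Proof.
under eq_fun do rewrite mxE; apply: measurable_nuclear_norm => a b.
under eq_fun do rewrite (block_mul_assemble _ _ _ _ _ _ _ C)// summxE.
apply: measurable_sumr => k _; under eq_fun do rewrite mxE.
apply: measurable_sumr => a' _; apply: measurable_funM => //.
exact: measurable_block_entry.
Qed.

End chernoff.

(** * Union bound and choice of the constants *)

Lemma measurable_forall_fin (dT : measure_display) (T : measurableType dT) (I : finType)
    (E : I -> set T) :
  (forall i, measurable (E i)) -> measurable [set t | forall i, E i t].
Proof.
move=> mE; rewrite (_ : [set t | _] = \bigcap_(i in [set: I]) E i).
  by apply: fin_bigcap_measurable => //; exact: finite_finset.
by apply/seteqP; split => t /= Et i; [move=> _; exact: Et|exact: Et].
Qed.

Lemma sgbm_separation (dT : measure_display) (T : measurableType dT) (R : realType)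
    (P : probability T R) (n K d : nat) (p q : R) (G : set 'M[R]_d)
    (Xs : 'M[R]_(n * d, d)) (Hs : 'M[R]_(n, K)) (C : 'I_n -> 'I_K)
    (A : T -> 'M[R]_(n * d, n * d)) (net : seq 'M[R]_d) (chi theta l l1 e eps : R) :
  (0 < d)%N -> G = @orthogonal_group R d \/ (G = @rotation_group R d /\ (1 < d)%N) ->
  0 <= p <= 1 -> 0 <= q <= 1 -> 0 < l -> 0 < l1 -> 0 <= e ->
  (forall B, B \in net -> contractive_mx B) ->
  (forall B, contractive_mx B ->
      exists2 B', B' \in net & forall a b, `|B a b - B' a b| <= e) ->
  stacks G Xs -> cluster_mx Hs -> clustering_of Hs C -> sgbm P p q G Xs C A ->
  let m : R := n%:R / K%:R in
  0 < chi * (m * p) ->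
  expR (l1 * (theta * (m * p)) + (m - 1) * (p * (expR (- l1) - 1))) <= eps ->
  expR (l * (chi * (m * p)) + ((m - 1) * (p * (expR (- l) - 1)) +
    m * (q * (expR (l * (e * d%:R)) * ((expR l + expR (- l)) / 2) - 1)))) <= eps ->
  let good := [set t |
    preserves (A t) (assemble Xs Hs) C (chi * (m * p)) /\
    forall i : 'I_n,
      theta * (m * p) <= mu_mx (A t *m assemble Xs Hs) i (C i)] in
  measurable good /\
  ((1 - n%:R * (1 + K%:R * (size net)%:R) * eps)%:E <= P good)%E.
Proof.
move=> d_gt0 hG p01 q01 l0 l1_gt0 e0 net_c netP XsG Hc HC [w [u [N model]]].
move=> m delta_gt0 eps1 eps2 good.
have d1 : 1 <= d%:R :> R by rewrite ler1n.
have eps_ge0 : 0 <= eps by apply: le_trans eps1; exact: expR_ge0.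
have cardC j : #|[set k | C k == j]%SET|%:R = m by exact: card_cluster Hc HC.
have cardI i : #|[set k | (k != i) && (C k == C i)]%SET|%:R = m - 1.
  rewrite -(cardC (C i)) (cardsD1 i [set k | C k == C i]%SET) inE eqxx /= add1n -natr1 addrK.
  by congr (_%:R); apply: eq_card => k; rewrite !inE.
pose x1 := theta * (m * p); pose x2 := chi * (m * p).
(* With an empty list of noise terms the joint bound reduces to the lower tail of the signal
   alone. *)
pose E1 i := [set t | signal C w i t - noise_value Xs u N 0 0 i [::] t <= x1].
pose E2 (z : 'I_n * 'I_K * 'M[R]_d) :=
  if z.1.2 != C z.1.1 then [set t | signal C w z.1.1 t
     - noise_value Xs u N z.2 e z.1.1 (enum [set k | C k == z.1.2]%SET) t <= x2]
  else set0.
have E1_le i : i \in enum 'I_n -> measurable (E1 i) /\ (P (E1 i) <= eps%:E)%E.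
  move=> _; have [|//|mE PE] := signal_noise_tail _ _ _ _ _ model d_gt0 hG XsG i [::] 0 l1 0 x1
    p01 q01 l1_gt0 (lexx _) (contractive_mx0 R d); first by [].
  split => //; apply: le_trans PE _; rewrite lee_fin.
  by rewrite mul0r addr0 cardI.
pose zs := [seq (ij, B) | ij <- enum {: 'I_n * 'I_K}, B <- net].
have E2_le z : z \in zs -> measurable (E2 z) /\ (P (E2 z) <= eps%:E)%E.
  move=> /allpairsP[[[i j] B] [/= _ Bnet ->]]; rewrite /E2 /=.
  case: ifPn => [ji|_]; last by rewrite measure0 lee_fin.
  have [||mE PE] := signal_noise_tail _ _ _ _ _ model d_gt0 hG XsG i
    (enum [set k | C k == j]%SET) B l e x2 p01 q01 l0 e0 (net_c _ Bnet).
  - exact: enum_uniq.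
  - by move=> k; rewrite mem_enum inE => /eqP ->.
  split => //; apply: le_trans PE _; rewrite lee_fin.
  by rewrite cardI -cardE cardC.
have [mF1 PF1] := measure_exists_mem_le _ _ _ P _ _ _ _ E1_le.
have [mF2 PF2] := measure_exists_mem_le _ _ _ P _ _ _ _ E2_le.
set F1 := [set t | _] in mF1 PF1; set F2 := [set t | _] in mF2 PF2.
have size_zs : (size zs)%:R = n%:R * (K%:R * (size net)%:R) :> R.
  by rewrite /zs size_allpairs -cardE card_prod !card_ord !natrM mulrA.
have signal_ge0 i t : 0 <= signal C w i t by apply: sumr_ge0 => k _; exact: ler0n.
have mu_signal i t : mu_mx (A t *m assemble Xs Hs) i (C i) = d%:R * (1 + signal C w i t).
  rewrite mxE (signal_block _ _ _ _ _ model hG XsG)//.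
  apply: nuclear_norm_scale_orthogonal; first by rewrite addr_ge0.
  exact: stack_block_orthogonal hG XsG i.
have good_sub : ~` (F1 `|` F2) `<=` good.
  move=> t /not_orP[nF1 nF2].
  have gt1 i : x1 < signal C w i t.
    rewrite ltNge; apply/negP => le1; apply: nF1; exists i; first by rewrite mem_enum.
    by rewrite /E1 /= /noise_value big_nil subr0.
  split; last first.
    move=> i; rewrite mu_signal; have := gt1 i; have := signal_ge0 i t; rewrite /x1; nra.
  split => //.
    exists Xs, Hs; split => // i.
    by have := XsG i; case: hG => [->//|[-> _] []].
  move=> i j ji; rewrite mu_signal mxE.
  have [B Bnet BX] := noise_nuclear_norm_le _ _ _ _ _ model d_gt0 _ Hc HC i j t e net e0 ji netP.
  have gt2 : x2 < signal C w i t - noise_value Xs u N B e i (enum [set k | C k == j]%SET) t.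
    rewrite ltNge; apply/negP => le2; apply: nF2; exists ((i, j), B).
      by apply: allpairs_f => //; rewrite mem_enum.
    by rewrite /E2 /= ji.
  (* The difference of the two norms is at least d (1 + signal - noise) > d (1 + x2), which exceeds
     x2 since d >= 1 and x2 > 0. *)
  move: delta_gt0; rewrite -/x2 => x2_gt0; nra.
have mgood : measurable good.
  rewrite (_ : good = [set t | forall z : 'I_n * 'I_K, (if z.2 != C z.1 then
        [set t | chi * (m * p) <= mu_mx (A t *m assemble Xs Hs) z.1 (C z.1)
           - mu_mx (A t *m assemble Xs Hs) z.1 z.2] else setT) t] `&`
      [set t | forall i, [set t | theta * (m * p) <= mu_mx (A t *m assemble Xs Hs) i (C i)] t]).
    have mmu := measurable_mu_mx _ _ _ _ _ model _ Hc HC.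
    have m_ge (c : R) (f : T -> R) : measurable_fun setT f -> measurable [set t | c <= f t].
      move=> mf; rewrite (_ : [set t | _] = setT `&` f @^-1` `[c, +oo[); first exact: mf.
      by apply/seteqP; split => t /=; rewrite in_itv/= andbT //; case.
    apply: measurableI; apply: measurable_forall_fin => z; last exact: m_ge.
    by case: ifP => // _; apply: m_ge; exact: measurable_funB.
  apply/seteqP; split => t /=.
    by move=> [[_ _ sep] ge]; split => // -[i j] /=; case: ifPn => // ji; exact: sep.
  move=> [sep ge]; split => //; split => //.
    exists Xs, Hs; split => // i.
    by have := XsG i; case: hG => [->//|[-> _] []].
  by move=> i j ji; have := sep (i, j); rewrite /= ji.
split => //.
have mU : measurable (F1 `|` F2) by exact: measurableU.
apply: (@le_trans _ _ (P (~` (F1 `|` F2)))); last first.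
  by apply: le_measure; rewrite ?inE//; exact: measurableC.
rewrite probability_setC// EFinB leeB//.
apply: le_trans (measureU2 _ mF1 mF2) _.
rewrite [leRHS](_ : _ = ((size (enum 'I_n))%:R * eps)%:E + ((size zs)%:R * eps)%:E)%E.
  exact: leeD.
by rewrite -EFinD size_zs size_enum_ord; congr (_%:E); ring.
Qed.

Theorem theorem2 (R : realType) (alpha beta : R) (K d : nat)
    (G : set 'M[R]_d)
    (alpha_gt0 : 0 < alpha) (beta_gt0 : 0 < beta)
    (K_gt0 : (0 < K)%N) (d_gt0 : (0 < d)%N)
    (hG : G = @orthogonal_group R d \/
          (G = @rotation_group R d /\ (1 < d)%N))
    (h1 : Num.sqrt (2 * K%:R * beta) < alpha)
    (h2 : K%:R < alpha - Num.sqrt (2 * K%:R * beta) *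
                   ln (expR 1 * alpha / Num.sqrt (2 * K%:R * beta))) :
  exists chi c : R, [/\ 0 < chi, 0 < c &
    \forall n \near \oo,
      let p : R := alpha * ln n%:R / n%:R in
      let q : R := beta * ln n%:R / n%:R in
      let m : R := n%:R / K%:R in
      forall (Xs : 'M[R]_(n * d, d)) (Hs : 'M[R]_(n, K))
        (Cs : 'I_n -> 'I_K),
        stacks G Xs -> cluster_mx Hs -> clustering_of Hs Cs ->
      let Vs := assemble Xs Hs in
      forall (dT : measure_display) (T : measurableType dT)
        (P : probability T R) (A : T -> 'M[R]_(n * d, n * d)),
        sgbm P p q G Xs Cs A ->
      let good := [set t |
        preserves (A t) Vs Cs (chi * (m * p)) /\
        forall i : 'I_n,
          Num.sqrt (2 * K%:R * beta) / alpha * (m * p)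
            <= mu_mx (A t *m Vs) i (Cs i)] in
      measurable good /\ ((1 - n%:R `^ (- c))%:E <= P good)%E].
Proof.
have k0 : 0 < K%:R :> R by rewrite ltr0n.
have d1 : 1 <= d%:R :> R by rewrite ler1n.
set s := Num.sqrt (2 * K%:R * beta) in h1 h2 *.
have s0 : 0 < s by rewrite sqrtr_gt0 !mulr_gt0.
have sE : s ^+ 2 = 2 * K%:R * beta by rewrite sqr_sqrtr// ltW// !mulr_gt0.
have [sK rate1] := separation_gap _ _ _ _ alpha_gt0 s0 k0 h1 h2.
have [l0 rate2] := joint_rate_gt _ _ _ _ _ s0 k0 sE sK.
set l := ln (1 + 2 * K%:R / s) in l0 rate2.
(* The optimal tilt for the event that the signal is at most (s / alpha) m p: it minimizes l1 s /
   alpha + exp (- l1), and the resulting rate is alpha - s - s log (alpha / s). *)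
set l1 := ln (alpha / s) in rate1.
have l1_gt0 : 0 < l1 by rewrite ln_gt0// ltr_pdivlMr// mul1r.
have el1 : expR (- l1) = s / alpha.
  by rewrite expRN lnK ?posrE ?divr_gt0// invf_div.
pose ch := (expR l + expR (- l)) / 2.
have ch0 : 0 < ch by rewrite divr_gt0// addr_gt0 ?expR_gt0.
have el_lt1 : expR (- l) < 1 by rewrite expR_lt1 oppr_lt0.
have A0 : 0 < alpha * (1 - expR (- l)) by rewrite mulr_gt0// subr_gt0.
have la0 : 0 < l * alpha by exact: mulr_gt0.
(* The threshold chi m p contains the factor alpha, so l alpha takes the place of l; the mesh e is
   then chosen to make l e d equal to l alpha eta. *)
have [chi [eta [chi0 eta0 rate3]]] := perturbed_rate _ _ _ _ _ _ A0 beta_gt0 la0 ch0 rate2.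
pose e := alpha * eta / d%:R.
have e0 : 0 < e by rewrite divr_gt0 ?mulr_gt0 ?ltr0n.
have ed : l * (e * d%:R) = l * alpha * eta.
  by rewrite /e divfK ?mulrA// pnatr_eq0 -lt0n.
have [net [net_c netP]] := contractive_mx_net R d e e0.
(* The excess of the two rates, divided by K, over 1: each bad event has probability of order n^(- 1
   - g), and the union over agents leaves n^(- g). *)
pose g1 := (alpha - s - s * l1) / K%:R - 1.
pose g2 := (alpha * (1 - expR (- l)) - l * alpha * chi
    - beta * (expR (l * alpha * eta) * ch - 1)) / K%:R - 1.
have g1_gt0 : 0 < g1 by rewrite subr_gt0 ltr_pdivlMr// mul1r.
have g2_gt0 : 0 < g2 by rewrite subr_gt0 ltr_pdivlMr// mul1r.
pose g := Num.min g1 g2.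
have g0 : 0 < g by rewrite lt_min g1_gt0.
(* The number of events per agent, times a factor e for the passage from m to m - 1. For large n
   half of the exponent g absorbs it, which gives c = g / 2. *)
pose C0 : R := (1 + K%:R * (size net)%:R) * expR 1.
have C0_gt0 : 0 < C0.
  by rewrite mulr_gt0 ?expR_gt0// ltr_pwDl// mulr_ge0.
exists chi, (g / 2); split => //; first by rewrite divr_gt0.
near=> n.
have n_gt1 : (1 < n)%N by near: n; exact: nbhs_infty_gt.
have n0 : 0 < n%:R :> R by rewrite ltr0n ltnW.
pose L : R := ln n%:R.
have L0 : 0 < L by rewrite ln_gt0// ltr1n.
have LC : 2 * ln C0 / g <= L.
  rewrite -[leLHS]expRK ler_ln ?posrE ?expR_gt0//.
  by near: n; exact: nbhs_infty_ger.
have p_le1 : alpha * ln n%:R / n%:R <= 1 by near: n; exact: ln_div_le1.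
have q_le1 : beta * ln n%:R / n%:R <= 1 by near: n; exact: ln_div_le1.
move=> Xs Hs C XsG Hc HC dT T P A.
set p := alpha * ln n%:R / n%:R in p_le1 *.
set q := beta * ln n%:R / n%:R in q_le1 *.
set m := n%:R / K%:R; move=> model.
have p01 : 0 <= p <= 1 by rewrite p_le1 andbT divr_ge0 ?mulr_ge0 ?ltW.
have q01 : 0 <= q <= 1 by rewrite q_le1 andbT divr_ge0 ?mulr_ge0 ?ltW.
have mp : m * p = alpha * L / K%:R.
  by rewrite /m /p -/L; field; rewrite !lt0r_neq0.
have mq : m * q = beta * L / K%:R.
  by rewrite /m /q -/L; field; rewrite !lt0r_neq0.
have mpx x : m * (p * x) = alpha * L / K%:R * x by rewrite mulrA mp.
have mqx x : m * (q * x) = beta * L / K%:R * x by rewrite mulrA mq.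
pose eps := expR (1 - (1 + g) * L).
(* The term p a' is the contribution of the agent missing from its own signal; it is at most 1
   because p and a' are. *)
have exponent a a' : g <= a / K%:R - 1 -> 0 <= a' <= 1 ->
    - (a / K%:R) * L + p * a' <= 1 - (1 + g) * L.
  move=> ga /andP[a0' a1']; have /andP[p0 p1] := p01.
  have : (1 + g) * L <= a / K%:R * L by rewrite (ler_wpM2r (ltW L0))//; lra.
  have : p * a' <= 1 by nra.
  lra.
have [g1_le g2_le] : g <= g1 /\ g <= g2 by rewrite !ge_min !lexx orbT.
have [|||mgood good_ge] := sgbm_separation _ _ _ P n K d p q G Xs Hs C A net chi (s / alpha)
  l l1 e eps d_gt0 hG p01 q01 l0 l1_gt0 (ltW e0) net_c netP XsG Hc HC model.
- by rewrite mp mulr_gt0// divr_gt0// mulr_gt0.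
- rewrite -/m ler_expR el1; apply: le_trans (exponent _ (1 - s / alpha) g1_le _).
    rewrite mulrBl mul1r mpx mp le_eqVlt; apply/orP; left; apply/eqP.
    by field; rewrite !lt0r_neq0.
  rewrite subr_ge0 ler_pdivrMr// mul1r ltW//= gerBl divr_ge0 ?ltW//.
- rewrite -/m ler_expR ed; apply: le_trans (exponent _ (1 - expR (- l)) g2_le _).
    rewrite mulrBl mul1r mpx mqx mp le_eqVlt; apply/orP; left; apply/eqP.
    by rewrite /ch; field; rewrite !lt0r_neq0.
  by rewrite subr_ge0 ltW//= gerBl expR_ge0.
split=> //; apply: le_trans good_ge; rewrite lee_fin lerD2l lerN2.
have -> : n%:R = expR L by rewrite lnK ?posrE.
rewrite /powR gt_eqF ?expR_gt0// expRK /eps.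
have -> : expR L * (1 + K%:R * (size net)%:R) * expR (1 - (1 + g) * L)
    = C0 * expR (- g * L).
  have -> : 1 - (1 + g) * L = 1 + (- L + - g * L) by ring.
  rewrite /C0 !expRD expRN; field; exact: lt0r_neq0 (expR_gt0 _).
rewrite -[C0]lnK ?posrE// -expRD ler_expR.
have : ln C0 <= L * g / 2 by move: LC; rewrite ler_pdivrMr//; lra.
lra.
Unshelve. all: by end_near. Qed.
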